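(* Fix $k<m$. Let $V=0\times\mathbb R^{m-1}$ as a constant hyperplane field on $I^m$, and let $\sigma_z:I^m\to J^r(\mathbb R^m,\mathbb R^n)$, $z\in I^q$, be a family of sections such that $\sigma_z=0$ on an open neighborhood of $\partial I^m$, $\sigma_z^\perp=0$ on $I^m$ with respect to $V$, and $\sigma_z=0$ on all of $I^m$ for $z$ in an open neighborhood of $\partial I^q$. Then for every $\varepsilon>0$ there exist a family of isotopies $F^z_t:I^m\to I^m$ and a family of holonomic sections $\hat\sigma_z$ such that: $\mathrm{dist}_{C^0}(\hat\sigma_z,\sigma_z)<\varepsilon$ on an open neighborhood of $F^z_1(I^k)$; $\|\hat\sigma^\perp_z\|_{C^0}<\varepsilon$ on $I^m$; $\mathrm{dist}_{C^0}(F^z_t,\mathrm{id})<\varepsilon$; $F^z_t=\mathrm{id}$ and $\hat\sigma_z=0$ on an open neighborhood of $\partial I^m$; $F^z_t=\mathrm{id}$ and $\hat\sigma_z=0$ on all of $I^m$ for $z$ in an open neighborhood of $\partial I^q$; and $V$ is invariant under $F^z_t$.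
   Context: $I=[-1,1]$, $I^k=I^k\times\{0\}^{m-k}\subset I^m$. $J^r(\mathbb R^m,\mathbb R^n)\cong\mathbb R^m\times(\mathcal P_r)^n$ via Taylor polynomials of degree $\le r$; $0$ is the jet of the zero map; holonomic means of the form $j^r(h)$. For the hyperplane field $V$, $\sigma^\perp$ of $j^r(h)(x)$ consists of all partial derivatives of $h$ at $x$ of order $\le r$ except the pure derivative $\partial_1^r$. *)

(* Defs.v *)
From HB Require Import structures.
From mathcomp Require Import all_boot all_order all_algebra.
From mathcomp Require Import all_classical all_reals all_analysis.
Set Implicit Arguments. Unset Strict Implicit. Unset Printing Implicit Defensive.
Import Order.TTheory GRing.Theory Num.Theory numFieldNormedType.Exports.
Local Open Scope classical_set_scope.
Local Open Scope ring_scope.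

Definition cube (R : realType) (m : nat) : set 'rV[R]_m :=
  [set x | forall i : 'I_m, -1 <= x ord0 i <= 1].

Definition cube_face (R : realType) (m k : nat) : set 'rV[R]_m :=
  [set x | cube x /\ forall i : 'I_m, (k <= i)%N -> x ord0 i = 0].

Definition cube_bd (R : realType) (m : nat) : set 'rV[R]_m :=
  [set x | cube x /\ exists i : 'I_m, `|x ord0 i| = 1].

Definition open_nbhd_with (T : topologicalType) (A : set T) (P : set T -> Prop) :=
  exists U : set T, open U /\ A `<=` U /\ P U.

Definition mindex (m : nat) := 'I_m -> nat.
Definition morder (m : nat) (a : mindex m) : nat := (\sum_(i < m) a i)%N.
Definition pure_index (m r : nat) : mindex m := fun i => if val i == 0%N then r else 0%N.

(* A section of J^r(R^m,R^n) over (a subset of) R^m: at each x, the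
   coordinates (value of the "partial derivative" d^a of the j-th component)
   for all multi-indices a; only those with |a| <= r are meaningful. *)
Definition jsection (R : realType) (m n : nat) := 'rV[R]_m -> mindex m -> 'I_n -> R.

Definition evec (R : realType) (m : nat) (i : 'I_m) : 'rV[R]_m := delta_mx 0 i.

Definition pderivs (R : realType) (m : nat) (l : seq 'I_m) (f : 'rV[R]_m -> R)
  : 'rV[R]_m -> R :=
  foldr (fun i g => 'D_(evec R i) g) f l.

Definition mdiff (R : realType) (m : nat) (a : mindex m) (f : 'rV[R]_m -> R) :=
  pderivs (flatten [seq nseq (a i) i | i <- enum 'I_m]) f.

Definition smooth (R : realType) (m : nat) (f : 'rV[R]_m -> R) :=
  (forall (l : seq 'I_m) (x : 'rV[R]_m) (i : 'I_m), derivable (pderivs l f) x (evec R i))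
  /\ (forall l : seq 'I_m, continuous (pderivs l f)).

Definition smoothv (R : realType) (p m : nat) (f : 'rV[R]_p -> 'rV[R]_m) :=
  forall j : 'I_m, smooth (fun x => f x ord0 j).

Definition jet (R : realType) (m n : nat) (h : 'I_n -> 'rV[R]_m -> R) : jsection R m n :=
  fun x a j => mdiff a (h j) x.

Definition jvanish (R : realType) (m n r : nat) (s : jsection R m n) (A : set 'rV[R]_m) :=
  forall x, A x -> forall (a : mindex m) (j : 'I_n), (morder a <= r)%N -> s x a j = 0.

Definition jclose (R : realType) (m n r : nat) (s1 s2 : jsection R m n)
  (A : set 'rV[R]_m) (eps : R) :=
  forall x, A x -> forall (a : mindex m) (j : 'I_n), (morder a <= r)%N ->
    `|s1 x a j - s2 x a j| < eps.

(* |s^perp| < eps on A, w.r.t. V = 0 x R^(m-1): s^perp = all coordinates of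
   order <= r except the pure one d_1^r. *)
Definition jperp_small (R : realType) (m n r : nat) (s : jsection R m n)
  (A : set 'rV[R]_m) (eps : R) :=
  forall x, A x -> forall (a : mindex m) (j : 'I_n), (morder a <= r)%N ->
    a <> @pure_index m r -> `|s x a j| < eps.

Definition jperp_zero (R : realType) (m n r : nat) (s : jsection R m n)
  (A : set 'rV[R]_m) :=
  forall x, A x -> forall (a : mindex m) (j : 'I_n), (morder a <= r)%N ->
    a <> @pure_index m r -> s x a j = 0.

Definition dom_zx (R : realType) (q m : nat) : set ('rV[R]_q * 'rV[R]_m) :=
  [set p | cube p.1 /\ cube p.2].
Definition dom_ztx (R : realType) (q m : nat) : set ('rV[R]_q * (R * 'rV[R]_m)) :=
  [set p | cube p.1 /\ (0 <= p.2.1 <= 1) /\ cube p.2.2].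

Definition jfamily_continuous (R : realType) (q m n r : nat)
  (s : 'rV[R]_q -> jsection R m n) :=
  forall (a : mindex m) (j : 'I_n), (morder a <= r)%N ->
    {within @dom_zx R q m, continuous (fun p => s p.1 p.2 a j)}.

Definition inV (R : realType) (m : nat) (v : 'rV[R]_m) :=
  forall i : 'I_m, val i = 0%N -> v ord0 i = 0.

Definition isotopy_family (R : realType) (q m : nat)
  (F : 'rV[R]_q -> R -> 'rV[R]_m -> 'rV[R]_m) :=
  [/\ forall z, cube z -> forall x, F z 0 x = x,
      forall z, cube z ->
        smoothv (fun y : 'rV[R]_(1 + m) => F z (y ord0 (lshift m ord0)) (rsubmx y)),
      forall z t, cube z -> 0 <= t <= 1 ->
        exists G : 'rV[R]_m -> 'rV[R]_m,
          [/\ smoothv G, cancel (F z t) G, cancel G (F z t) & F z t @` @cube R m = @cube R m]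
    & {within @dom_ztx R q m, continuous (fun p => F p.1 p.2.1 p.2.2)}].

(* Main.v *)
(* The only nonzero component of sigma_z is its pure derivative s(z,x), so it
   suffices to find a function whose r-th derivative in x_0 is close to s on the
   wiggled face while all its other derivatives of order at most r are small.
   Let P be a periodic function with P^(r) = 1 on most of each period. Then
   a^(-r) P (a x_0) and a^(-r) P (a x_0 + 1/2) have r-th derivative of size O(1)
   and lower derivatives O(1/a), and the r-th derivative of one of them is 1 for
   every x_0. The isotopy pushes the face to the graph x_last = delta w(a x_0) of
   a periodic wiggle w, for which x_last / delta tells which of the two functions
   is usable; they are blended by a cutoff in x_last / delta alone. As delta is
   fixed before a, by Leibniz' rule the blend does not create large mixed
   derivatives. Multiplying by s, regularised in x by a partition of unity
   on a grid with the values of s at the nodes as coefficients, gives the jets.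
   The isotopy is a vertical shear x + c(x) chi(x_last) e_last, where c does not
   depend on x_last and is small; its inverse is given by an implicit equation,
   whose solution is shown to be smooth by bootstrapping. *)
Require Import Defs.
From HB Require Import structures.
From mathcomp Require Import all_boot all_order all_algebra.
From mathcomp Require Import all_classical all_reals all_analysis.
From mathcomp Require Import ring lra.
Set Implicit Arguments. Unset Strict Implicit. Unset Printing Implicit Defensive.
Import Order.TTheory GRing.Theory Num.Theory numFieldNormedType.Exports.
Local Open Scope classical_set_scope.
Local Open Scope ring_scope.

(** * Functions with continuous iterated directional derivatives *)

Section Cn.
Variables (R : realType) (V : normedModType R).
Implicit Types (f g : V -> R) (n : nat).

(** Derivatives are taken along all vectors and counted by an order [n]: this makes sense on [R] and
    on row vectors alike, and closure properties follow by induction on [n]. [Cinf_smooth] leads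
    back to [smooth]. *)
Fixpoint Cn n f : Prop :=
  continuous f /\
  (if n is n'.+1 then (forall x v, derivable f x v) /\ (forall v, Cn n' ('D_v f))
   else True).

Definition Cinf f := forall n, Cn n f.

Lemma Cn_continuous {n f} : Cn n f -> continuous f.
Proof. by case: n => [|n] []. Qed.

Lemma Cn_derivable {n f} : Cn n.+1 f -> forall x v, derivable f x v.
Proof. by case=> _ []. Qed.

Lemma Cn_derive {n f} : Cn n.+1 f -> forall v, Cn n ('D_v f).
Proof. by case=> _ []. Qed.

Lemma CnS {n f} : Cn n.+1 f -> Cn n f.
Proof.
elim: n f => [|n IH] f [fc [fd fD]]; first by split.
by split=> //; split=> // v; apply: IH.
Qed.

Lemma CnS_intro {n f} : continuous f ->
  (forall v, exists df, (forall x, is_derive x v f (df x)) /\ Cn n df) ->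
  Cn n.+1 f.
Proof.
move=> fc H; split=> //; split=> [x v|v]; have [df [fdf Cdf]] := H v.
  exact: ex_derive.
rewrite (_ : 'D_v f = df) //; apply/funext => x.
by case: (fdf x).
Qed.

Lemma Cn_isd {n f} : Cn n.+1 f -> forall x v, is_derive x v f ('D_v f x).
Proof. by move=> Cf x v; apply: derivableP; apply: Cn_derivable Cf _ _. Qed.

Lemma Cn_cst n (a : R) : Cn n (fun _ => a).
Proof.
elim: n a => [|n IH] a; first by split=> // x; exact: cvg_cst.
apply: CnS_intro => [x|v]; first exact: cvg_cst.
by exists (fun=> 0); split=> // x; exact: is_derive_cst.
Qed.

Lemma is_derive_add f g x v df dg : is_derive x v f df -> is_derive x v g dg ->
  is_derive x v (fun y => f y + g y) (df + dg).
Proof. exact: is_deriveD. Qed.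

Lemma is_derive_mul f g x v (df dg : R) : is_derive x v f df -> is_derive x v g dg ->
  is_derive x v (fun y => f y * g y) (df * g x + f x * dg).
Proof.
move=> Hf Hg; apply: (is_derive_eq (is_deriveM Hf Hg)).
by rewrite addrC mulrC.
Qed.

Lemma is_derive_inv f x v (df : R) : f x != 0 -> is_derive x v f df ->
  is_derive x v (fun y => (f y)^-1) (- (df * ((f x)^-1 * (f x)^-1))).
Proof.
move=> f0 [fd fdf]; split; first exact: derivableV.
rewrite deriveV// fdf scaleNr; congr (- _); rewrite expr2 invfM.
exact: mulrC.
Qed.

Lemma derive_line f x v : 'D_v f x = 'D_1 (fun h : R => f (h *: v + x)) 0.
Proof.
rewrite /derive; set g1 := fun h => h^-1 *: _; set g2 := fun h => h^-1 *: _.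
suff -> : g1 = g2 by [].
by rewrite funeqE /g1 /g2 => h /=; rewrite addr0 scale0r add0r [_%:A]mulr1.
Qed.

(** Restricted to the line [h *: v + x], this is the chain rule in one variable, so that [f] is only
    differentiated along [v]. *)
Lemma is_derive_comp1 f (phi : R -> R) x v (df a : R) :
  is_derive (f x) 1 phi a -> is_derive x v f df ->
  is_derive x v (fun y => phi (f y)) (a * df).
Proof.
move=> Hp [fd fdf].
have e : f x = f (0 *: v + x) by rewrite scale0r add0r.
have H1 : is_derive (0 : R) 1 (fun h : R => f (h *: v + x)) df.
  split; first exact: (derivable1P f x v).1.
  by rewrite -derive_line.
rewrite e in Hp.
have [H2 H2'] := is_derive1_comp Hp H1.
split; first exact: (derivable1P (fun y => phi (f y)) x v).2.
by rewrite derive_line.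
Qed.

Lemma CnD n f g : Cn n f -> Cn n g -> Cn n (fun x => f x + g x).
Proof.
elim: n f g => [|n IH] f g Cf Cg.
  split=> // x; apply: cvgD; [exact: (Cn_continuous Cf)|exact: (Cn_continuous Cg)].
apply: CnS_intro => [x|v].
  apply: cvgD; [exact: (Cn_continuous Cf)|exact: (Cn_continuous Cg)].
exists (fun x => 'D_v f x + 'D_v g x); split; last exact: IH (Cn_derive Cf v) (Cn_derive Cg v).
by move=> x; apply: is_derive_add; [exact: Cn_isd Cf x v|exact: Cn_isd Cg x v].
Qed.

Lemma CnM n f g : Cn n f -> Cn n g -> Cn n (fun x => f x * g x).
Proof.
elim: n f g => [|n IH] f g Cf Cg.
  split=> // x; apply: cvgM; [exact: (Cn_continuous Cf)|exact: (Cn_continuous Cg)].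
apply: CnS_intro => [x|v].
  apply: cvgM; [exact: (Cn_continuous Cf)|exact: (Cn_continuous Cg)].
exists (fun x => 'D_v f x * g x + f x * 'D_v g x); split.
  by move=> x; apply: is_derive_mul; [exact: Cn_isd Cf x v|exact: Cn_isd Cg x v].
by apply: CnD; apply: IH; [exact: (Cn_derive Cf)|exact: CnS|exact: CnS|exact: (Cn_derive Cg)].
Qed.

Lemma CnN n f : Cn n f -> Cn n (fun x => - f x).
Proof.
move=> Cf; rewrite (_ : (fun x => - f x) = (fun x => -1 * f x)); last first.
  by apply/funext => x; rewrite mulN1r.
by apply: CnM => //; exact: Cn_cst.
Qed.

Lemma CnB n f g : Cn n f -> Cn n g -> Cn n (fun x => f x - g x).
Proof. by move=> Cf Cg; apply: CnD => //; exact: CnN. Qed.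

Lemma CnV n f : (forall x, f x != 0) -> Cn n f -> Cn n (fun x => (f x)^-1).
Proof.
move=> f0; elim: n => [|n IH] Cf.
  by split=> // x; apply: cvgV => //; exact: (Cn_continuous Cf).
apply: CnS_intro => [x|v].
  by apply: cvgV => //; exact: (Cn_continuous Cf).
exists (fun x => - ('D_v f x * ((f x)^-1 * (f x)^-1))); split.
  by move=> x; apply: is_derive_inv => //; exact: Cn_isd Cf x v.
by apply: CnN; apply: CnM; [exact: (Cn_derive Cf)|apply: CnM; exact: IH (CnS Cf)].
Qed.

Lemma Cn_sum n (I : Type) (s : seq I) (P : pred I) (F : I -> V -> R) :
  (forall i, P i -> Cn n (F i)) -> Cn n (fun x => \sum_(i <- s | P i) F i x).
Proof.
move=> CF; elim: s => [|i s IH].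
  by under eq_fun do rewrite big_nil; exact: Cn_cst.
under eq_fun do rewrite big_cons.
by case: (boolP (P i)) => Pi //=; apply: CnD => //; exact: CF _ Pi.
Qed.

Lemma Cn_prod n (I : Type) (s : seq I) (P : pred I) (F : I -> V -> R) :
  (forall i, P i -> Cn n (F i)) -> Cn n (fun x => \prod_(i <- s | P i) F i x).
Proof.
move=> CF; elim: s => [|i s IH].
  by under eq_fun do rewrite big_nil; exact: Cn_cst.
under eq_fun do rewrite big_cons.
by case: (boolP (P i)) => Pi //=; apply: CnM => //; exact: CF _ Pi.
Qed.

Lemma near_eq_continuous f g (x : V) : (\forall y \near x, f y = g y) ->
  continuous g -> {for x, continuous f}.
Proof.
move=> fg gc; rewrite /prop_for /continuous_at (nbhs_singleton fg).
apply: cvg_trans (gc x); apply: near_eq_cvg.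
by near=> y; apply/esym; near: y.
Unshelve. all: by end_near. Qed.

(** Locality serves for functions glued from smooth pieces, such as the periodic ones below. *)
Lemma Cn_local n f :
  (forall x : V, exists g, Cn n g /\ \forall y \near x, f y = g y) -> Cn n f.
Proof.
elim: n f => [|n IH] f H.
  split=> // x; have [g [Cg fg]] := H x.
  by apply: near_eq_continuous fg _; exact: Cn_continuous Cg.
split.
  move=> x; have [g [Cg fg]] := H x.
  by apply: near_eq_continuous fg _; exact: Cn_continuous Cg.
split=> [x v|v].
  have [g [Cg fg]] := H x; apply: (@near_eq_derivable _ _ _ g).
    by near=> y; apply/esym; near: y.
  exact: Cn_derivable Cg _ _.
apply: IH => x; have [g [Cg fg]] := H x.
exists ('D_v g); split; first exact: (Cn_derive Cg).
near=> y; apply: near_eq_derive; near: y.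
exact: (near_join fg).
Unshelve. all: by end_near. Qed.

End Cn.

Section Cn1.
Variable R : realType.

Lemma is_derive_dir (phi : R -> R) (x v : R) : derivable phi x 1 ->
  is_derive x v phi (v * derive1 phi x).
Proof.
move=> d; rewrite mulrC.
have di : is_derive x v (@id R) v by exact: is_derive_id.
apply: (@is_derive_comp1 _ _ (@id R) phi) => //.
by rewrite derive1E; apply: derivableP.
Qed.

Lemma Cn_derive1 n (phi : R -> R) : Cn n.+1 phi -> Cn n (derive1 phi).
Proof.
move=> C; rewrite (_ : (derive1 phi) = 'D_1 phi); last by apply/funext => x; rewrite derive1E.
exact: Cn_derive C 1.
Qed.

Lemma Cn_comp (V : normedModType R) n (phi : R -> R) (f : V -> R) :
  Cn n phi -> Cn n f -> Cn n (fun x => phi (f x)).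
Proof.
elim: n phi f => [|n IH] phi f Cp Cf.
  split=> // x; apply: continuous_comp; [exact: (Cn_continuous Cf)|exact: (Cn_continuous Cp)].
apply: CnS_intro => [x|v].
  apply: continuous_comp; [exact: (Cn_continuous Cf)|exact: (Cn_continuous Cp)].
exists (fun x => derive1 phi (f x) * 'D_v f x); split.
  move=> x; apply: is_derive_comp1; last exact: Cn_isd Cf x v.
  by rewrite derive1E; exact: Cn_isd Cp _ _.
by apply: CnM; [apply: IH; [exact: Cn_derive1|exact: CnS]|exact: (Cn_derive Cf)].
Qed.

Lemma CnS_intro1 n (phi dphi : R -> R) :
  (forall x : R, is_derive x 1 phi (dphi x)) -> Cn n dphi -> Cn n.+1 phi.
Proof.
move=> H C; apply: CnS_intro => [x|v].
  by apply/differentiable_continuous/derivable1_diffP; case: (H x).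
exists (fun x => v * dphi x); split; last by apply: CnM => //; exact: Cn_cst.
move=> x; have := @is_derive_dir phi x v.
by rewrite derive1E derive_val; apply; case: (H x).
Qed.

Lemma Cn_id n : Cn n (@id R).
Proof.
case: n => [|n]; first by split=> // x.
by apply: (@CnS_intro1 n id (fun=> 1)); exact: Cn_cst.
Qed.

Lemma is_derive_coord m (i : 'I_m) (x v : 'rV[R]_m) :
  is_derive x v (fun x : 'rV[R]_m => x ord0 i) (v ord0 i).
Proof.
apply: DeriveDef; first exact/diff_derivable/differentiable_coord.
have := derive_mx (@derivable_id R _ x v).
by rewrite derive_id => /matrixP/(_ ord0 i); rewrite mxE => ->.
Qed.

Lemma Cn_coord m n (i : 'I_m) : Cn n (fun x : 'rV[R]_m => x ord0 i).
Proof.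
case: n => [|n]; first by split=> //; exact: coord_continuous.
apply: CnS_intro; first exact: coord_continuous.
move=> v; exists (fun=> v ord0 i); split; last exact: Cn_cst.
move=> x; exact: is_derive_coord.
Qed.

End Cn1.

(** * Iterated partial derivatives and Leibniz' rule *)

Section Pderivs.
Variables (R : realType) (m : nat).
Implicit Types (f g : 'rV[R]_m -> R) (l : seq 'I_m).

Lemma pderivs_rcons l i f :
  pderivs (rcons l i) f = pderivs l ('D_(evec R i) f).
Proof. by rewrite /pderivs foldr_rcons. Qed.

Lemma Cn_pderivs l n f : Cn (size l + n) f -> Cn n (pderivs l f).
Proof.
elim: l n => [|i l IH] n //= Cf; apply: Cn_derive.
by apply: IH; rewrite addnS.
Qed.

Lemma Cinf_pderivs l f : Cinf f -> Cinf (pderivs l f).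
Proof. by move=> Cf n; apply: Cn_pderivs; exact: Cf. Qed.

Lemma Cinf_derive v f : Cinf f -> Cinf ('D_v f).
Proof. by move=> Cf n; exact: Cn_derive (Cf n.+1) v. Qed.

Lemma Cinf_smooth f : Cinf f -> smooth f.
Proof.
move=> Cf; split=> [l x i|l].
  exact: Cn_derivable (Cinf_pderivs l Cf 1) _ _.
exact: Cn_continuous (Cinf_pderivs l Cf 0).
Qed.

Lemma CinfM f g : Cinf f -> Cinf g -> Cinf (fun x => f x * g x).
Proof. by move=> Cf Cg n; exact: CnM. Qed.

Lemma CinfD f g : Cinf f -> Cinf g -> Cinf (fun x => f x + g x).
Proof. by move=> Cf Cg n; exact: CnD. Qed.

Lemma derive_eq_fun v f (df : 'rV[R]_m -> R) :
  (forall x, is_derive x v f (df x)) -> 'D_v f = df.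
Proof. by move=> H; apply/funext => x; case: (H x). Qed.

Lemma pderivsD l f g : Cinf f -> Cinf g ->
  pderivs l (fun x => f x + g x) = (fun x => pderivs l f x + pderivs l g x).
Proof.
move=> Cf Cg; elim: l => //= i l ->; apply: derive_eq_fun => x.
by apply: is_derive_add; [exact: Cn_isd (Cinf_pderivs l Cf 1) _ _|exact: Cn_isd (Cinf_pderivs l Cg 1) _ _].
Qed.

Lemma pderivs_cst0 l : pderivs l (fun _ : 'rV[R]_m => 0 : R) = (fun=> 0).
Proof.
elim: l => //= i l ->; apply: derive_eq_fun => x; exact: is_derive_cst.
Qed.

Lemma pderivsZ l (a : R) f : Cinf f ->
  pderivs l (fun x => a * f x) = (fun x => a * pderivs l f x).
Proof.
move=> Cf; elim: l => //= i l ->; apply: derive_eq_fun => x.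
have H := Cn_isd (Cinf_pderivs l Cf 1) x (evec R i).
have := is_derive_mul (is_derive_cst a x (evec R i)) H.
by rewrite mul0r add0r.
Qed.

Lemma pderivs_sumZ (I : Type) (s : seq I) l (a : I -> R) (F : I -> 'rV[R]_m -> R) :
  (forall i, Cinf (F i)) ->
  pderivs l (fun x => \sum_(i <- s) a i * F i x) =
  (fun x => \sum_(i <- s) a i * pderivs l (F i) x).
Proof.
move=> CF; elim: s => [|i s IH].
  under eq_fun do rewrite big_nil; rewrite pderivs_cst0.
  by apply/funext => x; rewrite big_nil.
under eq_fun do rewrite big_cons.
rewrite pderivsD; last 2 first.
- by move=> n; apply: CnM; [exact: Cn_cst|exact: CF].
- by move=> n; apply: Cn_sum => j _; apply: CnM; [exact: Cn_cst|exact: CF].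
by apply/funext => x; rewrite big_cons IH pderivsZ.
Qed.

Lemma pderivs_near l f g (x : 'rV[R]_m) :
  (\forall y \near x, f y = g y) -> \forall y \near x, pderivs l f y = pderivs l g y.
Proof.
move=> fg; elim: l => //= i l IH.
near=> y; apply: near_eq_derive; near: y; exact: (near_join IH).
Unshelve. all: by end_near. Qed.

Lemma pderivs_local l f g (x : 'rV[R]_m) :
  (\forall y \near x, f y = g y) -> pderivs l f x = pderivs l g x.
Proof. by move=> /(pderivs_near l)/nbhs_singleton. Qed.

(* In Leibniz' rule the terms of d^l (f g) other than f d^l g only involve
   derivatives of g along proper subsequences of l. *)
Lemma pderivsM_approx l f g x (M e : R) : Cinf f -> Cinf g -> 0 <= M -> 0 <= e ->
  (forall l', subseq l' l -> `|pderivs l' f x| <= M) ->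
  (forall l', subseq l' l -> l' != l -> `|pderivs l' g x| <= e) ->
  `|pderivs l (fun y => f y * g y) x - f x * pderivs l g x| <= 3 ^+ size l * (M * e).
Proof.
(* [pderivs] applies the last entry of the list first. Peeling it off differentiates the product
   itself and leaves two products for the induction hypothesis. *)
move=> + + M0 e0; elim/last_ind: l f g => [|l i IH] f g Cf Cg Hf Hg.
  by rewrite /= subrr normr0 mul1r mulr_ge0.
have sub l' : subseq l' l -> subseq (rcons l' i) (rcons l i).
  by move=> ll'; rewrite -!cats1 cat_subseq.
have subr l' : subseq l' l -> subseq l' (rcons l i).
  by move=> ll'; apply: (subseq_trans ll'); exact: subseq_rcons.
have neq l' : subseq l' l -> l' != rcons l i.
  move=> /size_subseq ll'; apply/eqP => E; move: ll'.
  by rewrite E size_rcons ltnn.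
rewrite !pderivs_rcons.
have -> : 'D_(evec R i) (fun y => f y * g y) =
    (fun y => 'D_(evec R i) f y * g y + f y * 'D_(evec R i) g y).
  by apply: derive_eq_fun => y; apply: is_derive_mul; [exact: Cn_isd (Cf 1) _ _|exact: Cn_isd (Cg 1) _ _].
rewrite pderivsD; [|by apply: CinfM => //; exact: Cinf_derive..].
have H1 := IH _ _ (Cinf_derive (evec R i) Cf) Cg.
have H2 := IH _ _ Cf (Cinf_derive (evec R i) Cg).
have {}H1 : `|pderivs l (fun y => 'D_(evec R i) f y * g y) x -
    'D_(evec R i) f x * pderivs l g x| <= 3 ^+ size l * (M * e).
  apply: H1 => l' ll'; first by rewrite -pderivs_rcons; exact/Hf/sub.
  by move=> _; apply: Hg (subr _ ll') (neq _ ll').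
have {}H2 : `|pderivs l (fun y => f y * 'D_(evec R i) g y) x -
    f x * pderivs l ('D_(evec R i) g) x| <= 3 ^+ size l * (M * e).
  apply: H2 => l' ll'; first exact/Hf/subr.
  move=> nl; rewrite -pderivs_rcons; apply: Hg; first exact: sub.
  by rewrite (inj_eq (@rcons_injl _ i)).
have H3 : `|'D_(evec R i) f x * pderivs l g x| <= M * e.
  rewrite normrM ler_pM//; last exact: Hg (subr _ (subseq_refl _)) (neq _ (subseq_refl _)).
  have := Hf [:: i]; apply; rewrite -cats1; exact: suffix_subseq.
have p1 : 1 <= 3 ^+ size l :> R by rewrite exprn_ege1// ler1n.
rewrite size_rcons exprS.
set A := pderivs l _ x in H1 *; set B := pderivs l _ x in H2 *.
set C := pderivs l _ x in H2 *.
(* Two inductive errors and the term with ['D_i f], where [g] is differentiated along the proper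
   subsequence [l]: three terms, hence the base 3. *)
rewrite (_ : A + B - f x * C = (A - 'D_(evec R i) f x * pderivs l g x) +
  (B - f x * C) + 'D_(evec R i) f x * pderivs l g x); last by ring.
apply: (le_trans (ler_normD _ _)).
apply: (le_trans (lerD (ler_normD _ _) (lexx _))).
have Me : 0 <= M * e by rewrite mulr_ge0.
have : M * e <= 3 ^+ size l * (M * e) by rewrite ler_peMl.
lra.
Qed.

Lemma pderivs_coord l (i : 'I_m) (phi : R -> R) : Cinf phi ->
  pderivs l (fun x => phi (x ord0 i)) =
  (fun x => if all (pred1 i) l then derive1n (size l) phi (x ord0 i) else 0).
Proof.
elim/last_ind: l phi => [|l j IH] phi Cp; first by [].
rewrite pderivs_rcons.
have Cp' : Cinf (derive1 phi) by move=> n; exact: Cn_derive1.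
have -> : 'D_(evec R j) (fun x : 'rV[R]_m => phi (x ord0 i)) =
   (fun x => (i == j)%:R * (derive1 phi (x ord0 i))).
  apply: derive_eq_fun => x; rewrite mulrC; apply: is_derive_comp1.
    by rewrite derive1E; exact: Cn_isd (Cp 1) _ _.
  by have := is_derive_coord i x (evec R j); rewrite mxE eqxx.
rewrite pderivsZ; last by move=> n; apply: Cn_comp; [exact: Cp'|exact: Cn_coord].
rewrite IH// all_rcons size_rcons; apply/funext => x /=.
rewrite eq_sym; case: eqP => _ /=; last by rewrite mul0r.
by rewrite mul1r -derive1Sn.
Qed.

End Pderivs.

(** * Iterated derivatives in one variable *)

Section OneDim.
Variable R : realType.
Implicit Types phi psi : R -> R.

Lemma Cinf_derive1n k phi : Cinf phi -> Cinf (derive1n k phi).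
Proof.
move=> C; elim: k => // k IH n; rewrite derive1nS; exact: Cn_derive1.
Qed.

Lemma Cinf_affine (a b : R) : Cinf (fun u => a * u + b).
Proof.
move=> n; apply: CnD; last exact: Cn_cst.
by apply: CnM; [exact: Cn_cst|exact: Cn_id].
Qed.

Lemma derive1n_affine k phi (c a b : R) : Cinf phi ->
  derive1n k (fun u => c * phi (a * u + b)) =
  (fun u => c * a ^+ k * derive1n k phi (a * u + b)).
Proof.
move=> C; elim: k => [|k IH]; first by apply/funext => u; rewrite /= expr0 mulr1.
rewrite derive1nS IH; apply/funext => u; rewrite derive1E exprSr.
have Ck := Cinf_derive1n k C.
have H1 : is_derive u 1 (fun u : R => a * u + b) a.
  have := is_derive_add (is_derive_mul (is_derive_cst a u 1) (is_derive_id u 1)) (is_derive_cst b u 1).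
  by rewrite mul0r mulr1 add0r addr0.
have H2 : is_derive (a * u + b) 1 (derive1n k phi) (derive1n k.+1 phi (a * u + b)).
  by rewrite derive1nS derive1E; exact: Cn_isd (Ck 1) _ _.
have H3 := is_derive_mul (is_derive_cst (c * a ^+ k) u 1)
  (@is_derive_comp1 _ _ (fun u : R => a * u + b) _ _ _ _ _ H2 H1).
have [_ ->] := H3; rewrite /cst; ring.
Qed.

Lemma derive1n_near k phi psi (x : R) :
  (\forall y \near x, phi y = psi y) -> \forall y \near x, derive1n k phi y = derive1n k psi y.
Proof.
move=> fg; elim: k => // k IH; rewrite !derive1nS.
near=> y; rewrite !derive1E; apply: near_eq_derive; near: y; exact: (near_join IH).
Unshelve. all: by end_near. Qed.

Lemma derive1n_local k phi psi (x : R) :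
  (\forall y \near x, phi y = psi y) -> derive1n k phi x = derive1n k psi x.
Proof. by move=> /(derive1n_near k)/nbhs_singleton. Qed.

Lemma derive1n_monomial r (a : R) (x : R) :
  derive1n r (fun u => (u - a) ^+ r / r`!%:R) x = 1.
Proof.
elim: r => [|r IH]; first by rewrite /= expr0 mul1r invr1.
rewrite derive1Sn (_ : derive1 _ = (fun u => (u - a) ^+ r / r`!%:R))//.
apply/funext => u; rewrite derive1E.
have H0 : is_derive u 1 (fun u : R => u - a) 1.
  have := is_derive_add (is_derive_id u 1) (is_derive_cst (- a) u 1).
  by rewrite addr0.
have H1 : is_derive u 1 (fun u : R => (u - a) ^+ r.+1) (r.+1%:R * (u - a) ^+ r).
  have HX : is_derive (u - a) 1 (fun u : R => u ^+ r.+1) (r.+1%:R * (u - a) ^+ r).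
    apply: DeriveDef; first exact: exprn_derivable.
    by rewrite exp_derive; exact: mulr1.
  have := @is_derive_comp1 _ _ (fun u : R => u - a) _ _ _ _ _ HX H0.
  by rewrite mulr1.
have H2 := is_derive_mul H1 (is_derive_cst (r.+1`!%:R^-1 : R) u 1).
have [_ ->] := H2; rewrite /cst mulr0 addr0 factS natrM invfM.
by rewrite mulrACA divff ?mul1r// pnatr_eq0.
Qed.

End OneDim.

(** * Smooth steps, bumps and periodic profiles *)

Section SmoothStep.
Variable R : realType.

(* The derivatives of exp (-1/u), u > 0, extended by 0, are combinations of these. *)
Definition flat k (u : R) : R := if 0 < u then (u ^+ k)^-1 * expR (- u^-1) else 0.

(** Put [y = 1 / ((k+2) u)]. Raising [exp y >= y] to the power [k+2] bounds [exp (-1/u)] by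
    [((k+2) u)^(k+2)], and one factor [u] survives the division by [u^(k+1)]. *)
Lemma flat_le k (u : R) : 0 < u -> flat k.+1 u <= k.+2%:R ^+ k.+2 * u.
Proof.
move=> u0; rewrite /flat u0.
have nu : 0 < k.+2%:R * u by rewrite mulr_gt0.
have H : expR (- u^-1) <= (k.+2%:R * u) ^+ k.+2.
  have -> : - u^-1 = - ((k.+2%:R * u)^-1 * k.+2%:R).
    by congr (- _); field; rewrite lt0r_neq0//= -!natr1 -addrA -natrD pnatr_eq0 addn1.
  rewrite expRN expRM_natr -[X in _ <= X ^+ _]invrK exprVn.
  rewrite lef_pV2 ?posrE ?exprn_gt0 ?expR_gt0 ?invr_gt0//.
  rewrite lerXn2r ?nnegrE ?expR_ge0 ?invr_ge0 ?(ltW nu)//.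
  by apply: le_trans (expR_ge1Dx _); rewrite ler_wpDl.
have uk : 0 < u ^+ k.+1 by rewrite exprn_gt0.
rewrite mulrC ler_pdivrMr//; apply: (le_trans H).
by rewrite exprMn [u ^+ k.+2]exprS mulrA.
Qed.

Lemma flat_ge0 k (u : R) : 0 <= flat k u.
Proof.
rewrite /flat; case: ifP => // u0.
by rewrite mulr_ge0 ?expR_ge0// invr_ge0 exprn_ge0// ltW.
Qed.

Lemma is_derive_flat k (u : R) :
  is_derive u 1 (flat k) (flat k.+2 u - k%:R * flat k.+1 u).
Proof.
have [u0|u0|->] := ltgtP u 0.
- rewrite /flat ltNge (ltW u0)/= mulr0 subr0.
  apply: (@near_eq_is_derive R R R (cst 0) _ u 1).
  near=> v; rewrite ltNge (_ : v <= 0)//.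
  by apply/ltW; near: v; exact: lt_nbhsl.
- apply: (@near_eq_is_derive R R R (fun v => (v ^+ k)^-1 * expR (- v^-1)) _ u 1).
    near=> v; rewrite /flat (_ : 0 < v)//; near: v; exact: lt_nbhsr.
  rewrite /flat u0.
  have HX : is_derive u 1 (fun u : R => u ^+ k) (k%:R * u ^+ k.-1).
    apply: DeriveDef; first exact: exprn_derivable.
    by rewrite exp_derive; exact: mulr1.
  have H1 := @is_derive_inv _ _ (fun v : R => v ^+ k) u 1 _ (lt0r_neq0 (exprn_gt0 k u0)) HX.
  have H2 : is_derive u 1 (fun v : R => - v^-1) (u^-1 * u^-1).
    have := is_derive_mul (is_derive_cst (-1 : R) u 1)
      (@is_derive_inv _ _ (@id R) u 1 _ (lt0r_neq0 u0) (is_derive_id u 1)).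
    rewrite mul0r add0r /cst mulN1r mul1r opprK.
    by under eq_fun do rewrite mulN1r.
  have H3 := @is_derive_comp1 _ _ (fun v : R => - v^-1) (@expR R) u 1 _ _ (is_derive_expR _) H2.
  apply: (is_derive_eq (is_derive_mul H1 H3)).
  have un0 := lt0r_neq0 u0.
  case: k {HX H1 H3} => [|k]; first by rewrite /= !expr0 !mul0r; field.
  rewrite /= !exprS; have : u ^+ k != 0 by rewrite expf_neq0.
  move: (u ^+ k) (expR _) (k.+1%:R : R) => X e c X0; field.
  by rewrite X0 un0.
- rewrite /flat ltxx mulr0 subr0 -/(flat k).
  (* For [h > 0] the difference quotient at 0 is [flat k.+1 h], which tends to 0 by [flat_le]; for
     [h < 0] it is 0. *)
  have H : (fun h : R => h^-1 *: ((flat k \o shift 0) (h *: (1 : R)) - flat k 0)) @ 0^' --> (0 : R).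
    apply/cvgrPdist_le => e e0.
    near=> h.
    have h0 : h != 0 by near: h; exact: nbhs_dnbhs_neq.
    rewrite sub0r normrN /= addr0 [_%:A]mulr1 [flat k 0]/flat ltxx subr0.
    have [hp|hn] := ltP 0 h; last first.
      by rewrite /flat ltNge hn/= scaler0 normr0 ltW.
    have -> : h^-1 *: flat k h = flat k.+1 h.
      by rewrite /flat hp [LHS]mulrA exprS invfM.
    rewrite ger0_norm ?flat_ge0//; apply: (le_trans (flat_le _ hp)).
    rewrite mulrC -ler_pdivlMr ?exprn_gt0//.
    rewrite -[h]gtr0_norm//; near: h; apply: dnbhs0_le.
    by rewrite divr_gt0// exprn_gt0.
  have H' : derivable (flat k) (0 : R) 1 by apply/cvg_ex; exists 0.
  by split=> //; apply: cvg_lim H.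
Unshelve. all: by end_near. Qed.

Lemma Cinf_flat k : Cinf (flat k).
Proof.
move=> n; elim: n k => [|n IH] k.
  split=> // x; apply/differentiable_continuous/derivable1_diffP.
  by case: (is_derive_flat k x).
apply: (CnS_intro1 (is_derive_flat k)).
by apply: CnB; [|apply: CnM; [exact: Cn_cst|]]; exact: IH.
Qed.

Lemma smooth_step_exists : exists S : R -> R, [/\ Cinf S,
  forall u, u <= 0 -> S u = 0, forall u, 1 <= u -> S u = 1 & forall u, 0 <= S u <= 1].
Proof.
pose E := flat 0.
have E0 u : 0 <= E u by exact: flat_ge0.
have Ep u : 0 < u -> 0 < E u by move=> u0; rewrite /E /flat u0 expr0 invr1 mul1r expR_gt0.
have En u : u <= 0 -> E u = 0 by move=> u0; rewrite /E /flat ltNge u0.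
have D u : 0 < E u + E (1 - u).
  have [u0|u0] := ltP 0 u; first by rewrite ltr_wpDr// Ep.
  by rewrite ltr_wpDl// Ep// subr_gt0 (le_lt_trans u0).
exists (fun u => E u * (E u + E (1 - u))^-1); split=> [n|u u0|u u1|u].
- apply: CnM; first exact: Cinf_flat.
  apply: CnV => [x|]; first exact/lt0r_neq0/D.
  apply: CnD; first exact: Cinf_flat.
  apply: (@Cn_comp R R n E (fun u : R => 1 - u)); first exact: Cinf_flat.
  by apply: CnB; [exact: Cn_cst|exact: Cn_id].
- by rewrite En// mul0r.
- by rewrite (En (1 - u)) ?addr0 ?divff ?lt0r_neq0 ?Ep ?subr_le0// (lt_le_trans ltr01).
- by rewrite divr_ge0 ?(ltW (D u))// ler_pdivrMr// mul1r lerDl E0.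
Qed.

Lemma bump_exists (a b : R) : a < b -> exists rho : R -> R, [/\ Cinf rho,
  forall u, `|u| <= a -> rho u = 1, forall u, b <= `|u| -> rho u = 0 &
  forall u, 0 <= rho u <= 1].
Proof.
move=> ab; have [S [SC S0 S1 S01]] := smooth_step_exists.
have ba : 0 < b - a by rewrite subr_gt0.
pose c := (b - a)^-1.
have c0 : 0 < c by rewrite invr_gt0.
have E1 u : - c * u + b * c = (b - u) * c by ring.
have E2 u : c * u + b * c = (b + u) * c by ring.
exists (fun u => S (- c * u + b * c) * S (c * u + b * c)); split=> [n|u|u bu|u].
- by apply: CnM; apply: (@Cn_comp R R n S); [exact: SC|exact: Cinf_affine|exact: SC|exact: Cinf_affine].
- rewrite ler_norml => /andP[u1 u2].
  by rewrite !S1 ?mulr1// ?E1 ?E2 ler_pdivlMr//; lra.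
- move: bu; rewrite ler_normr => /orP[H|H].
    by rewrite S0 ?mul0r// E1 pmulr_lle0//; lra.
  by rewrite (S0 (c * u + _)) ?mulr0// E2 pmulr_lle0//; lra.
- have /andP[p1 p2] := S01 (- c * u + b * c); have /andP[p3 p4] := S01 (c * u + b * c).
  by rewrite mulr_ge0//= mulr_ile1.
Qed.

Lemma near_dist (x e : R) : 0 < e -> \forall y \near x, `|x - y| < e.
Proof. exact: nbhsx_ballx. Qed.

Lemma derive1n_bounded (phi : R -> R) (b : R) k : Cinf phi ->
  (forall u, b <= `|u| -> phi u = 0) -> exists2 C, 0 <= C & forall u, `|derive1n k phi u| <= C.
Proof.
move=> C phi0; pose B := `|b| + 1.
have cf : {within `[- B, B], continuous (fun u => `|derive1n k phi u|)}.
  apply: continuous_subspaceT => x; apply: continuous_comp; last exact: norm_continuous.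
  exact: Cn_continuous (Cinf_derive1n k C 0) x.
have BB : - B <= B by rewrite /B; have := normr_ge0 b; lra.
have [c _ Hc] := EVT_max BB cf.
exists `|derive1n k phi c| => // u.
have [uB|uB] := leP `|u| B; first by apply: Hc; rewrite in_itv/= -ler_norml.
(* The margin 1 in [B] makes [phi] vanish near [u]. The zero function is written in this form so
   that [derive1n_affine] computes its derivatives. *)
rewrite (@derive1n_local _ k _ (fun u => 0 * phi (0 * u + 0))).
  by rewrite derive1n_affine// !mul0r normr0.
near=> v; rewrite mul0r phi0//; apply/ltW.
have : `|u| - `|v| <= `|u - v| by exact: lerB_dist.
have : `|u - v| < 1 by near: v; exact: near_dist.
have := ler_norm b; rewrite /B in uB; lra.
Unshelve. all: by end_near. Qed.

Lemma lipschitz_of_bounded_derive1 (phi : R -> R) (C : R) : Cinf phi ->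
  (forall u, `|derive1 phi u| <= C) -> forall x y, `|phi x - phi y| <= C * `|x - y|.
Proof.
move=> Cp HC.
have K a b : a <= b -> `|phi b - phi a| <= C * `|b - a|.
  move=> ab; have [x _| |c _ ->] := @MVT_segment _ phi (derive1 phi) a b ab.
  - by rewrite derive1E; exact: Cn_isd (Cp 1) _ _.
  - by apply: continuous_subspaceT; exact: Cn_continuous (Cp 0).
  - by rewrite normrM ler_wpM2r.
by move=> x y; have [/K|/ltW/K//] := leP x y; rewrite distrC [`|y - x|]distrC.
Qed.

Lemma floor_half (u : R) : `|u - (Num.floor (u + 1 / 2))%:~R| <= 1 / 2.
Proof.
have /andP[] := floor_itv (u + 1 / 2).
rewrite intrD mulr1z; move: (_%:~R) => v h1 h2.
by apply/ler_normlP; split; lra.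
Qed.

(** The integer translates of [tau] have disjoint supports, and [P] uses the one at the nearest
    integer. The formula with a fixed [i] persists up to distance [9/16 = 1 - 7/16], beyond the
    midpoint where the nearest integer jumps; this overlap makes [P] smooth. *)
Lemma periodize (tau : R -> R) : Cinf tau -> (forall u, 7 / 16 <= `|u| -> tau u = 0) ->
  exists P : R -> R, Cinf P /\
    forall (i : int) (u : R), `|u - i%:~R| < 9 / 16 -> P u = tau (u - i%:~R).
Proof.
move=> Ct t0; pose P (u : R) := tau (u - (Num.floor (u + 1 / 2))%:~R).
have HP (i : int) (u : R) : `|u - i%:~R| < 9 / 16 -> P u = tau (u - i%:~R).
  rewrite /P => ui; set j := Num.floor _.
  have [->//|ji] := eqVneq j i.
  have uj : `|u - j%:~R| <= 1 / 2 by exact: floor_half.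
  have : 1 <= `|(j - i)%:~R : R|.
    by rewrite -intr_norm ler1z -gtz0_ge1 normr_gt0 subr_eq0.
  rewrite rmorphB/= => ji1.
  have := ler_distD u j%:~R i%:~R => D.
  rewrite [`|j%:~R - u|]distrC in D.
  have h1 : 7 / 16 <= `|u - i%:~R| by lra.
  have h2 : 7 / 16 <= `|u - j%:~R| by lra.
  by rewrite !t0.
exists P; split=> // n; apply: Cn_local => x.
pose i := Num.floor (x + 1 / 2); exists (fun u : R => tau (1 * u + - i%:~R)); split.
  apply: (@Cn_comp R R n tau); [exact: Ct|exact: Cinf_affine].
near=> y; rewrite mul1r; apply: HP.
have : `|x - y| < 1 / 16 by near: y; apply: near_dist; lra.
have : `|x - i%:~R| <= 1 / 2 by exact: floor_half.
have := ler_distD x y i%:~R; rewrite [`|y - x|]distrC; lra.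
Unshelve. all: by end_near. Qed.

(* [P] and its half-period shift both have r-th derivative 1 on long arcs of
   the period. The part of the wiggle [w] above its minimum lies over the first
   arc and the part below its maximum over the second one. *)
Lemma wiggle_exists r : exists (P w : R -> R) (C : R), [/\ Cinf P, Cinf w,
  0 <= C /\ (forall k u, (k <= r)%N -> `|derive1n k P u| <= C),
  (forall u, 0 <= w u <= 1) /\ w 0 = 1 &
  (forall u, w u != 0 -> derive1n r P u = 1) /\
  (forall u, w u != 1 -> derive1n r P (u + 1 / 2) = 1)].
Proof.
(* Within 3/8 of an integer, [P] is a translate of [u^r / r!], with r-th derivative 1. The bump [b]
   of the wiggle is supported there. Where it is not 1, the distance to the integers exceeds
   [1/8 = 1/2 - 3/8], so the half-period shift lands within 3/8 of an integer. *)
have [rho [rC rho1 rho0 rho01]] := @bump_exists (3 / 8) (7 / 16) ltac:(lra).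
have [b [bC b1 b0 b01]] := @bump_exists (1 / 8) (3 / 8) ltac:(lra).
pose tau u := rho u * (u ^+ r / r`!%:R).
have tauC : Cinf tau.
  move=> n; apply: CnM; first exact: rC.
  apply: CnM; last exact: Cn_cst.
  rewrite (_ : (fun u => u ^+ r) = (fun u => \prod_(i < r) u)); last first.
    by apply/funext => u; rewrite prodr_const card_ord.
  apply: Cn_prod => i _; exact: Cn_id.
have tau0 u : 7 / 16 <= `|u| -> tau u = 0 by move=> /rho0 e; rewrite /tau e mul0r.
have [P [PC HP]] := periodize tauC tau0.
have b0' (u : R) : 7 / 16 <= `|u| -> b u = 0 by move=> H; apply: b0; lra.
have [w [wC Hw]] := periodize bC b0'.
have near_int (u : R) : exists i : int, `|u - i%:~R| <= 1 / 2.
  by exists (Num.floor (u + 1 / 2)); exact: floor_half.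
have [C C0 HC] : exists2 C, 0 <= C & forall k u, (k <= r)%N -> `|derive1n k tau u| <= C.
  elim: (r) => [|n [C C0 IH]].
    have [C C0 HC] := derive1n_bounded 0 tauC tau0.
    by exists C => // k u; rewrite leqn0 => /eqP ->.
  have [C' C'0 HC'] := derive1n_bounded n.+1 tauC tau0.
  exists (C + C'); first by rewrite addr_ge0.
  move=> k u; rewrite leq_eqVlt => /orP[/eqP ->|/IH H].
    by apply: le_trans (HC' u) _; rewrite lerDr.
  by apply: le_trans (H u) _; rewrite lerDl.
have Pnear (u : R) (i : int) : `|u - i%:~R| <= 1 / 2 -> \forall v \near u, P v = tau (v - i%:~R).
  move=> ui; near=> v; apply: HP.
  have : `|u - v| < 1 / 16 by near: v; apply: near_dist; lra.
  have := ler_distD u v i%:~R; rewrite [`|v - u|]distrC; lra.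
have P1 (u : R) (i : int) : `|u - i%:~R| < 3 / 8 -> derive1n r P u = 1.
  move=> ui; rewrite -[RHS](@derive1n_monomial R r i%:~R u); apply: derive1n_local.
  near=> v; have uv : `|u - v| < 3 / 8 - `|u - i%:~R|.
    by near: v; apply: near_dist; lra.
  have vi : `|v - i%:~R| < 3 / 8.
    by have := ler_distD u v i%:~R; rewrite [`|v - u|]distrC; lra.
  by rewrite (HP i) /tau ?rho1 ?mul1r//; lra.
exists P, w, C; split=> //.
- split=> // k u kr; have [i Hi] := near_int u.
  rewrite (derive1n_local k (Pnear u i Hi)).
  have := derive1n_affine k 1 1 (- i%:~R) tauC.
  under eq_fun do rewrite !mul1r; move=> ->.
  by rewrite expr1n !mul1r HC.
- split; last by rewrite (Hw 0) subr0 ?b1// normr0; lra.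
  by move=> u; have [i Hi] := near_int u; rewrite (Hw i) ?b01//; lra.
- split=> u; have [i Hi] := near_int u; rewrite (Hw i); [|lra| |lra].
    move=> bn; apply: (P1 u i); rewrite ltNge; apply/negP => /b0 e.
    by rewrite e eqxx in bn.
  move=> bn.
  have : 1 / 8 < `|u - i%:~R|.
    by rewrite ltNge; apply/negP => /b1 e; rewrite e eqxx in bn.
  rewrite lter_normr => /orP[H|H].
    apply: (P1 _ (i + 1)); rewrite intrD mulr1z.
    by move: Hi => /ler_normlP[? ?]; apply/ltr_normlP; split; lra.
  apply: (P1 _ i).
  by move: Hi => /ler_normlP[? ?]; apply/ltr_normlP; split; lra.
Unshelve. all: by end_near. Qed.

End SmoothStep.

(** * Shears and their smooth inverses *)

Section Implicit.
Variables (R : realType) (V : normedModType R).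

Lemma is_derive_lineP (f : V -> R) (x v : V) (d : R) :
  is_derive x v f d <-> is_derive (0 : R) 1 (fun h : R => f (h *: v + x)) d.
Proof.
split=> -[fd fdf]; split.
- exact: (derivable1P f x v).1.
- by rewrite -derive_line.
- exact: (derivable1P f x v).2.
- by rewrite derive_line.
Qed.

Lemma line_continuous (f : V -> R) (x v : V) : continuous f ->
  {for (0 : R), continuous (fun h : R => f (h *: v + x))}.
Proof.
move=> fc; apply: (@continuous_comp _ _ _ (fun h : R => h *: v + x) f); last exact: fc.
by apply: cvgD; [apply: cvgZr_tmp; exact: cvg_id|exact: cvg_cst].
Qed.

Variables (c y gam : V -> R) (chi : R -> R) (L : R).
Hypotheses (Cc : Cinf c) (Cy : Cinf y) (Cchi : Cinf chi).
Hypotheses (chiL : forall u, `|derive1 chi u| <= L).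
Hypothesis cL : forall x, `|c x| * L <= 1 / 2.
Hypothesis gamE : forall x, gam x + c x * chi (gam x) = y x.

Let lip := lipschitz_of_bounded_derive1 Cchi chiL.

(** In the difference of the equations at [x] and [z], the variation of [chi (gam _)] contributes at
    most half of [|gam x - gam z|] and is absorbed; the rest is controlled by the continuity of [y]
    and [c]. *)
Lemma implicit_continuous : continuous gam.
Proof.
move=> x; apply/cvgrPdist_lt => e e0.
pose K := 1 + `|chi (gam x)|.
have K0 : 0 < K by rewrite ltr_pwDl.
have eK : 0 < e / 4 / K by rewrite !divr_gt0.
near=> z.
have yz : `|y x - y z| < e / 4.
  near: z; apply: (cvgrPdist_lt _ _).1; last by rewrite divr_gt0.
  exact: Cn_continuous (Cy 0) x.
have cz : `|c x - c z| < e / 4 / K.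
  near: z; apply: (cvgrPdist_lt _ _).1; last by [].
  exact: Cn_continuous (Cc 0) x.
have E : gam x - gam z = (y x - y z) - (c z * (chi (gam x) - chi (gam z)) + (c x - c z) * chi (gam x)).
  by rewrite -!gamE; ring.
have h1 : `|c z * (chi (gam x) - chi (gam z))| <= 1 / 2 * `|gam x - gam z|.
  rewrite normrM; apply: le_trans (ler_wpM2l (normr_ge0 _) (lip _ _)) _.
  by rewrite mulrA ler_wpM2r.
have h2 : `|(c x - c z) * chi (gam x)| <= e / 4.
  rewrite normrM -[leRHS](divfK (lt0r_neq0 K0)); apply: ler_pM => //; first exact: ltW.
  by rewrite /K lerDr.
have := ler_normB (y x - y z) (c z * (chi (gam x) - chi (gam z)) + (c x - c z) * chi (gam x)).
rewrite -E; have := ler_normD (c z * (chi (gam x) - chi (gam z))) ((c x - c z) * chi (gam x)).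
lra.
Unshelve. all: by end_near. Qed.

Lemma one_add_neq0 (u : R) : `|u| <= 1 / 2 -> 1 + u != 0.
Proof.
move=> /ler_normlP[? ?]; apply: lt0r_neq0; lra.
Qed.

(* Caratheodory's form of the derivative: with chi z - chi (gam x) = D z * (z - gam x),
   the increment of gam is (dy - chi (gam x) dc) / (1 + c * D). *)
Lemma is_derive_implicit x v : is_derive x v gam
  (('D_v y x - 'D_v c x * chi (gam x)) * (1 + c x * derive1 chi (gam x))^-1).
Proof.
apply/is_derive_lineP.
have /is_derive_lineP/is_derive1_caratheodory[gy [Ey cy gy0]] := Cn_isd (Cy 1) x v.
have /is_derive_lineP/is_derive1_caratheodory[gc [Ec cc gc0]] := Cn_isd (Cc 1) x v.
have /is_derive1_caratheodory[D [ED cD D0]] := Cn_isd (Cchi 1) (gam x) (1 : R).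
(* The difference quotients of [chi] obey the bound on its derivative, so the denominator
   [1 + c * D] is nonzero everywhere and not only in the limit. *)
have DL u : `|D u| <= L.
  have [->|un] := eqVneq u (gam x); first by rewrite D0 -derive1E.
  have := lip u (gam x); rewrite ED normrM ler_pM2r// normr_gt0 subr_eq0//.
apply/is_derive1_caratheodory.
have nz h : 1 + c (h *: v + x) * D (gam (h *: v + x)) != 0.
  apply: one_add_neq0; rewrite normrM; apply: le_trans (cL (h *: v + x)).
  by rewrite ler_wpM2l.
exists (fun h => (gy h - gc h * chi (gam x)) * (1 + c (h *: v + x) * D (gam (h *: v + x)))^-1).
split.
- move=> h; have := Ey h; have := Ec h; rewrite scale0r add0r subr0 => E1 E2.
  have E3 := ED (gam (h *: v + x)).
  apply: (mulfI (nz h)); rewrite !mulrA [X in _ = X * _]mulrC -!mulrA mulKf//.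
  rewrite mulrDl mul1r -!mulrA -E3 [RHS]mulrBl.
  rewrite -E2 mulrAC -E1 -!gamE; ring.
- apply: cvgM.
    apply: cvgB; first exact: cy.
    by apply: cvgM; [exact: cc|exact: cvg_cst].
  apply: cvgV; first exact: nz.
  apply: cvgD; first exact: cvg_cst.
  apply: cvgM; first exact: line_continuous (Cn_continuous (Cc 0)).
  apply: (@continuous_comp _ _ _ (fun h : R => gam (h *: v + x)) D).
    exact: line_continuous implicit_continuous.
  by rewrite scale0r add0r.
- by rewrite gy0 gc0 scale0r add0r D0 -derive1E.
Qed.

(** Bootstrapping: the formula for the derivative of [gam] involves only [gam] itself and smooth
    data, so it is as regular as [gam]. *)
Lemma Cinf_implicit : Cinf gam.
Proof.
elim=> [|n IH]; first by split=> //; exact: implicit_continuous.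
apply: CnS_intro; first exact: implicit_continuous.
move=> v; eexists; split; first by move=> x; exact: is_derive_implicit.
apply: CnM.
  apply: CnB; first exact: Cn_derive (Cy _) _.
  by apply: CnM; [exact: Cn_derive (Cc _) _|exact: Cn_comp].
apply: CnV => [x|].
  apply: one_add_neq0; rewrite normrM; apply: le_trans (cL x).
  by rewrite ler_wpM2l.
apply: CnD; first exact: Cn_cst.
by apply: CnM => //; apply: Cn_comp => //; exact: Cn_derive1.
Qed.

End Implicit.

Section Shear.
Variables (R : realType) (m : nat) (j : 'I_m).
Variables (c : 'rV[R]_m -> R) (chi : R -> R) (L : R).
Hypotheses (Cc : Cinf c) (Cchi : Cinf chi).
Hypotheses (chiL : forall u, `|derive1 chi u| <= L).
Hypothesis chi1 : forall u, `|chi u| <= 1.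
Hypothesis cL : forall x, `|c x| * L <= 1 / 2.
Hypothesis cj : forall x s, c (x + s *: evec R j) = c x.

Definition shear (x : 'rV[R]_m) := x + (c x * chi (x ord0 j)) *: evec R j.

Lemma add_evecE (x : 'rV[R]_m) s i :
  (x + s *: evec R j) ord0 i = x ord0 i + s * (i == j)%:R.
Proof. by rewrite !mxE eqxx. Qed.

Lemma fibre_surj (a y : R) : `|a| * L <= 1 / 2 -> exists u, u + a * chi u = y.
Proof.
(* The perturbation is at most [|a|], so the values at [y - B] and [y + B] lie on either side of
   [y]. *)
move=> aL; pose B := `|a| + 1.
have B0 : 0 <= B by rewrite addr_ge0.
have h u : `|a * chi u| <= `|a| by rewrite normrM ler_piMr.
have yB : y - B <= y + B by lra.
have [||u _ <-] := @IVT R (fun u => u + a * chi u) (y - B) (y + B) y yB.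
- apply: continuous_subspaceT => x; apply: cvgD; first exact: cvg_id.
  by apply: cvgM; [exact: cvg_cst|exact: Cn_continuous (Cchi 0) x].
- have /ler_normlP[h1 h2] := h (y - B); have /ler_normlP[h3 h4] := h (y + B).
  rewrite ge_min le_max /B in h1 h2 h3 h4 *; apply/andP; split; apply/orP; [left|right]; lra.
- by exists u.
Qed.

Lemma fibre_inj (a u u' : R) : `|a| * L <= 1 / 2 -> u + a * chi u = u' + a * chi u' -> u = u'.
Proof.
move=> aL E; apply/eqP; rewrite -subr_eq0 -normr_le0.
have e : u - u' = - (a * (chi u - chi u')) by rewrite mulrBr; lra.
have : `|u - u'| <= 1 / 2 * `|u - u'|.
  rewrite {1}e normrN normrM.
  apply: le_trans (ler_wpM2l (normr_ge0 _) (lipschitz_of_bounded_derive1 Cchi chiL _ _)) _.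
  by rewrite mulrA ler_wpM2r.
lra.
Qed.

(** By [cj] the coefficient is constant on each line in direction [j], and the shear acts on that
    line as the bijection [u + c * chi u]. The inverse coordinate [gam] solves an implicit equation,
    so [Cinf_implicit] makes it smooth. *)
Lemma shear_inverse : exists G : 'rV[R]_m -> 'rV[R]_m,
  [/\ smoothv G, cancel shear G & cancel G shear].
Proof.
have [gam gamE] := choice (fun x : 'rV[R]_m => fibre_surj (x ord0 j) (cL x)).
have Cg : Cinf gam := Cinf_implicit Cc (fun n => Cn_coord R n j) Cchi chiL cL gamE.
pose G (x : 'rV[R]_m) := x + (gam x - x ord0 j) *: evec R j.
have Gj x : G x ord0 j = gam x by rewrite add_evecE eqxx mulr1 addrC subrK.
exists G; split.
- move=> i; apply: Cinf_smooth => n; under eq_fun do rewrite add_evecE.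
  apply: CnD; first exact: Cn_coord.
  by apply: CnM; [apply: CnB; [exact: Cg|exact: Cn_coord]|exact: Cn_cst].
- move=> x; have E : gam (shear x) = x ord0 j.
    apply: (@fibre_inj (c x)) => //.
    by rewrite -(cj x (c x * chi (x ord0 j))) gamE add_evecE eqxx mulr1 cj.
  rewrite /G E add_evecE eqxx mulr1 /shear -addrA -scalerDl.
  rewrite -[RHS]addr0; congr (_ + _); rewrite -[RHS](scale0r (evec R j)).
  by congr (_ *: _); ring.
- move=> x; rewrite /shear Gj /G cj -addrA -scalerDl.
  rewrite -[RHS]addr0; congr (_ + _); rewrite -[RHS](scale0r (evec R j)).
  by congr (_ *: _); rewrite -(gamE x); ring.
Qed.

End Shear.

(** * Compactness of the cube and partitions of unity *)

Section Cube.
Variable R : realType.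

Lemma cube_compact m : compact (@cube R m).
Proof.
rewrite (_ : @cube R m = [set v : 'rV[R]_m | forall i, `[-1, 1]%classic (v ord0 i)]).
  by apply: (@rV_compact R m (fun=> `[-1, 1]%classic)) => i; exact: segment_compact.
by apply/seteqP; split=> x /= H i; have := H i; rewrite in_itv.
Qed.

Lemma mx_norm_lt m (x : 'rV[R]_m) (e : R) : 0 < e -> (forall i, `|x ord0 i| < e) -> `|x| < e.
Proof.
move=> e0 H; rewrite [ltLHS]/Num.Def.normr/= mx_normrE.
by apply: bigmax_lt => // -[i j] _ /=; rewrite ord1.
Qed.

Lemma cube_norm m (x : 'rV[R]_m) i : cube x -> `|x ord0 i| <= 1.
Proof. by move=> /(_ i); rewrite -ler_norml. Qed.

(** By compactness it is enough to argue near one point [x], for small [rho]. If [x] is on the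
    boundary, nearby points are in [U]; otherwise their coordinates stay below [1 - rho] in absolute
    value. *)
Lemma collar m (U : set 'rV[R]_m) : open U -> @cube_bd R m `<=` U ->
  exists2 rho : R, 0 < rho & forall x, cube x -> (exists i, 1 - rho < `|x ord0 i|) -> U x.
Proof.
move=> Uo UB.
have /compact_near_coveringP/near_covering_withinP H := @cube_compact m.
have {}H : \forall rho \near (0 : R)^'+, @cube R m `<=`
    [set x : 'rV[R]_m | (exists i, 1 - rho < `|x ord0 i|) -> U x].
  apply: H => x Cx.
  have [[i xi]|nb] := pselect (exists i, `|x ord0 i| = 1).
    have Ux : U x by apply: UB; split=> //; exists i.
    exists (U, setT) => /=; first by split; [exact: open_nbhs_nbhs|exact: filterT].
    by move=> -[y s] [].
  have lt1 i : `|x ord0 i| < 1.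
    rewrite lt_neqAle cube_norm// andbT; apply/eqP => xi; apply: nb; exists i.
    exact: xi.
  near=> y rho => _ [i].
  rewrite ltNge => /negP; case.
  have h1 : `|y ord0 i| < (1 + `|x ord0 i|) / 2.
    move: i; near: y; apply: filter_forall => i.
    have h : `|x ord0 i| < (1 + `|x ord0 i|) / 2 by have := lt1 i; lra.
    have cc : {for x, continuous (fun y : 'rV[R]_m => `|y ord0 i|)}.
      by apply: continuous_comp; [exact: coord_continuous|exact: norm_continuous].
    exact: (cvgr_lt _ cc _ h).
  have h2 : rho < (1 - `|x ord0 i|) / 2.
    move: i {h1}; near: rho; apply: filter_forall => i.
    by apply: nbhs_right_lt; have := lt1 i; lra.
  by rewrite /=; lra.
near (0 : R)^'+ => rho.
exists rho => // x Cx; exact: (near H rho) x Cx.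
Unshelve. all: by end_near. Qed.

Lemma dom_zx_compact q m : compact (@dom_zx R q m).
Proof. exact: compact_setX (@cube_compact q) (@cube_compact m). Qed.

Lemma dom_zx_bounded q m (f : 'rV[R]_q * 'rV[R]_m -> R) :
  {within @dom_zx R q m, continuous f} -> exists2 M, 0 <= M & forall p, dom_zx p -> `|f p| <= M.
Proof.
move=> fc.
have /compact_bounded[M [_ HM]] := continuous_compact fc (@dom_zx_compact q m).
exists (`|M| + 1); first by rewrite addr_ge0.
move=> p dp; apply: (HM (`|M| + 1)); last by exists p.
by rewrite (le_lt_trans (ler_norm _))// ltrDl.
Qed.

(** Heine's argument on the product of the cubes: near each point both values differ by less than
    [eta / 2] from the value there. *)
Lemma dom_zx_uniform q m (f : 'rV[R]_q * 'rV[R]_m -> R) (eta : R) : 0 < eta ->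
  {within @dom_zx R q m, continuous f} -> exists2 d : R, 0 < d &
  forall z x y, cube z -> cube x -> cube y -> `|x - y| < d -> `|f (z, x) - f (z, y)| < eta.
Proof.
move=> eta0 /subspace_continuousP fc.
have /compact_near_coveringP/near_covering_withinP H := @dom_zx_compact q m.
have {}H : \forall d \near (0 : R)^'+, @dom_zx R q m `<=`
    [set p | forall y, cube y -> `|p.2 - y| < d -> `|f p - f (p.1, y)| < eta].
  apply: H => -[z0 x0] D0.
  have /cvgrPdist_lt/(_ (eta / 2)) := fc _ D0.
  rewrite divr_gt0// => /(_ isT) [[A B] /= [/nbhs_ballP[e1 /= e10 H1] /nbhs_ballP[e2 /= e20 H2]] AB].
  near=> p d => -[Cp1 Cp2] y Cy yd.
  have hz : ball z0 e1 p.1.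
    near: p; exists (ball z0 e1, setT) => /=; last by move=> -[? ?] [].
    by split; [exact: nbhsx_ballx|exact: filterT].
  have hx : ball x0 (e2 / 2) p.2.
    near: p; exists (setT, ball x0 (e2 / 2)) => /=; last by move=> -[? ?] [].
    by split; [exact: filterT|apply: nbhsx_ballx; rewrite divr_gt0].
  have hd : d <= e2 / 2 by near: d; apply: nbhs_right_le; rewrite divr_gt0.
  have hx' : ball x0 e2 p.2 by apply: le_ball hx; rewrite ler_pdivrMr//; lra.
  have hy : ball x0 e2 y.
    rewrite [e2]splitr; apply: ball_triangle hx _.
    by rewrite -ball_normE /=; exact: lt_le_trans hd.
  have k1 : `|f (z0, x0) - f p| < eta / 2.
    by apply: (AB p); [split; [exact: H1|exact: H2]|split].
  have k2 : `|f (z0, x0) - f (p.1, y)| < eta / 2.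
    by apply: (AB (p.1, y)); [split; [exact: H1|exact: H2]|split].
  have := ler_distD (f (z0, x0)) (f p) (f (p.1, y)); rewrite [`|f p - f (z0, x0)|]distrC; lra.
suff [d [d0 Hd]] : exists d, 0 < d /\ @dom_zx R q m `<=`
    [set p | forall y, cube y -> `|p.2 - y| < d -> `|f p - f (p.1, y)| < eta].
  by exists d => // z x y Cz Cx; exact: (Hd (z, x) (conj Cz Cx)).
by near (0 : R)^'+ => d; exists d; split=> //; near: d; exact: H.
Unshelve. all: by end_near. Qed.

Lemma pderivs_bounded m n (f : 'rV[R]_m -> R) : Cinf f -> exists2 M, 0 <= M &
  forall l x, (size l <= n)%N -> cube x -> `|pderivs l f x| <= M.
Proof.
elim: n f => [|n IH] f Cf.
  have fc : {within @cube R m, continuous f}.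
    apply: continuous_subspaceT; exact: Cn_continuous (Cf 0%N).
  have /compact_bounded[M [_ HM]] := continuous_compact fc (@cube_compact m).
  exists (`|M| + 1); first by rewrite addr_ge0.
  move=> l x; rewrite leqn0 size_eq0 => /eqP -> Cx; apply: (HM (`|M| + 1)); last by exists x.
  by rewrite (le_lt_trans (ler_norm _))// ltrDl.
have [M0 M00 H0] := IH f Cf.
have /choice[M HM] : forall i : 'I_m, exists M, 0 <= M /\
    forall l x, (size l <= n)%N -> cube x -> `|pderivs l ('D_(evec R i) f) x| <= M.
  by move=> i; have [M] := IH _ (Cinf_derive (evec R i) Cf); exists M.
have Mge0 : 0 <= \sum_i M i by apply: sumr_ge0 => i _; exact: (HM i).1.
exists (M0 + \sum_i M i); first by rewrite addr_ge0.
case/lastP => [|l i] x.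
  by move=> _ Cx; apply: le_trans (H0 [::] x _ Cx) _; rewrite ?lerDl.
rewrite size_rcons ltnS pderivs_rcons => ln Cx.
apply: le_trans ((HM i).2 _ _ ln Cx) _.
rewrite ler_wpDl// (bigD1 i)//= lerDl; apply: sumr_ge0 => k _; exact: (HM k).1.
Qed.

End Cube.

Section PartitionOfUnity.
Variable R : realType.

(** Differences of successive translates of a step: their sum telescopes to 1, and each is supported
    within one mesh width [2 / N < d] of its node. Both end points are nodes, hence [N.+1] of
    them. *)
Lemma grid1_exists (d : R) : 0 < d -> exists (N : nat) (pt : 'I_N -> R) (theta : 'I_N -> R -> R),
  [/\ forall i, -1 <= pt i <= 1, forall i, Cinf (theta i), forall i u, 0 <= theta i u,
      forall u : R, -1 <= u <= 1 -> \sum_i theta i u = 1 &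
      forall i (u : R), d <= `|u - pt i| -> theta i u = 0].
Proof.
move=> d0; have [S [SC S0 S1 S01]] := smooth_step_exists R.
pose N := (Num.truncn (2 / d)).+1.
have N0 : 0 < N%:R :> R by rewrite ltr0n.
have Nd : 2 / N%:R < d.
  rewrite ltr_pdivrMr// mulrC -ltr_pdivrMr//; exact: truncnS_gt.
pose th (k : nat) (u : R) := S (N%:R / 2 * u + (N%:R / 2 - k%:R + 1)) - S (N%:R / 2 * u + (N%:R / 2 - k%:R)).
exists N.+1, (fun i => -1 + 2 * i%:R / N%:R), (fun i => th i).
have E u (k : R) : N%:R / 2 * u + (N%:R / 2 - k) = (u - (-1 + 2 * k / N%:R)) * (N%:R / 2).
  by field; rewrite lt0r_neq0.
split.
- move=> i; have iN : i%:R <= N%:R :> R by rewrite ler_nat -ltnS.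
  have : 0 <= 2 * i%:R / N%:R :> R by rewrite divr_ge0// mulr_ge0.
  have : 2 * i%:R / N%:R <= 2 :> R by rewrite ler_pdivrMr// ler_pM2l.
  lra.
- move=> i n; apply: CnB; apply: (@Cn_comp R R n S);
    [exact: SC|exact: Cinf_affine|exact: SC|exact: Cinf_affine].
- move=> i u; rewrite /th addrA; set v := _ * u + _.
  have := S01 (v + 1); have := S01 v.
  have [v0|v0] := leP v 0; first by rewrite (S0 v)//; lra.
  rewrite (S1 (v + 1)); last lra; lra.
- move=> u /andP[u1 u2].
  have T (n : nat) : \sum_(i < n) th i u =
      S (N%:R / 2 * u + (N%:R / 2 + 1)) - S (N%:R / 2 * u + (N%:R / 2 - n%:R + 1)).
    elim: n => [|n IH]; first by rewrite big_ord0 subr0 subrr.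
    rewrite big_ord_recr/= IH /th -[n.+1%:R]natr1.
    by rewrite (_ : N%:R / 2 - (n%:R + 1) + 1 = N%:R / 2 - n%:R); [ring|ring].
  rewrite T S1; last by nra.
  rewrite S0 ?subr0// -[N.+1%:R]natr1; nra.
- move=> i u du; rewrite /th.
  have h : 1 <= `|N%:R / 2 * u + (N%:R / 2 - i%:R)|.
    rewrite E normrM [`|_ / 2|]ger0_norm ?divr_ge0//.
    rewrite [leLHS](_ : 1 = 2 / N%:R * (N%:R / 2) :> R); last by field; rewrite lt0r_neq0.
    by rewrite ler_pM2r ?divr_gt0//; apply/ltW/(lt_le_trans Nd).
  rewrite addrA; move: h; set v := _ + (_ - _) => h.
  move: h; rewrite ler_normr => /orP[h|h].
    by rewrite !S1 ?subrr//; lra.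
  by rewrite !S0 ?subrr//; lra.
Qed.

(** Products of one-dimensional partitions, indexed by choice functions so that distributivity turns
    their sum into a product of sums equal to 1. *)
Lemma partition_of_unity m (d : R) : 0 < d ->
  exists (I : finType) (pt : I -> 'rV[R]_m) (phi : I -> 'rV[R]_m -> R),
  [/\ forall p, cube (pt p), forall p, Cinf (phi p), forall p x, 0 <= phi p x,
      forall x, cube x -> \sum_p phi p x = 1 &
      forall p (x : 'rV[R]_m) i, d <= `|x ord0 i - pt p ord0 i| -> phi p x = 0].
Proof.
move=> d0; have [N [pt [th [pt1 thC th0 thS thd]]]] := grid1_exists d0.
exists {ffun 'I_m -> 'I_N}, (fun p : {ffun 'I_m -> 'I_N} => \row_i pt (p i)),
  (fun (p : {ffun 'I_m -> 'I_N}) (x : 'rV[R]_m) => \prod_i th (p i) (x ord0 i)).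
split.
- by move=> p i; rewrite mxE; exact: pt1.
- move=> p n; apply: Cn_prod => i _; apply: Cn_comp; [exact: thC|exact: Cn_coord].
- by move=> p x; apply: prodr_ge0 => i _; exact: th0.
- move=> x Cx; rewrite -(bigA_distr_bigA (fun i j => th j (x ord0 i))) /=.
  by apply: big1 => i _; apply: thS; exact: Cx.
- by move=> p x i; rewrite mxE => H; rewrite (bigD1 i)//= (thd _ _ H) mul0r.
Qed.

End PartitionOfUnity.

(** * Oscillating functions and their jets *)

Section MultiIndex.
Variable m : nat.
Implicit Type a : mindex m.

Definition mlist a := flatten [seq nseq (a i) i | i <- enum 'I_m].

Lemma size_mlist a : size (mlist a) = morder a.
Proof.
rewrite size_flatten /shape -map_comp sumnE big_map big_enum /=.
by apply: eq_bigr => i _; rewrite size_nseq.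
Qed.

Lemma count_mlist a i : count_mem i (mlist a) = a i.
Proof.
rewrite count_flatten -map_comp sumnE big_map big_enum /= (bigD1 i)//=.
rewrite count_nseq /= eqxx mul1n big1 ?addn0// => k ki.
by rewrite count_nseq /= (negbTE ki) mul0n.
Qed.

(** Counting the entries of [mlist a] recovers [a], and a list of length [r] in which [i0] occurs
    [r] times is constant. *)
Lemma mlist_pureP r (i0 : 'I_m) a : val i0 = 0%N ->
  mlist a = nseq r i0 <-> a = @pure_index m r.
Proof.
move=> i00.
have pureE i : @pure_index m r i = ((i0 == i) * r)%N.
  rewrite /pure_index -i00; case: (eqVneq i0 i) => [->|ne]; first by rewrite eqxx mul1n.
  by case: eqP => // /val_inj e; rewrite e eqxx in ne.
split=> [H|->].
  by apply/funext => i; rewrite -count_mlist H count_nseq pureE.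
have sz : size (mlist (@pure_index m r)) = r.
  rewrite size_mlist /morder (bigD1 i0)//= pureE eqxx mul1n big1 ?addn0// => i ne.
  by rewrite pureE eq_sym (negbTE ne).
rewrite -{2}sz; apply/all_pred1P; rewrite all_count sz.
by rewrite count_mlist pureE eqxx mul1n.
Qed.

End MultiIndex.

Section Oscillation.
Variables (R : realType) (m r : nat) (i0 : 'I_m) (P : R -> R) (C : R).
Hypothesis CP : Cinf P.
Hypothesis PC : forall k u, (k <= r)%N -> `|derive1n k P u| <= C.

Definition osc (a b u : R) : R := (a ^+ r)^-1 * P (a * u + b).

Lemma Cinf_osc a b : Cinf (osc a b).
Proof.
move=> n; apply: CnM; first exact: Cn_cst.
by apply: (@Cn_comp R R n P); [exact: CP|exact: Cinf_affine].
Qed.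

Lemma Cinf_osc_coord a b : Cinf (fun x : 'rV[R]_m => osc a b (x ord0 i0)).
Proof. by move=> n; apply: Cn_comp; [exact: Cinf_osc|exact: Cn_coord]. Qed.

Lemma pderivs_osc a b l (x : 'rV[R]_m) :
  pderivs l (fun x : 'rV[R]_m => osc a b (x ord0 i0)) x =
  if all (pred1 i0) l
  then (a ^+ r)^-1 * a ^+ size l * derive1n (size l) P (a * x ord0 i0 + b) else 0.
Proof. by rewrite pderivs_coord ?derive1n_affine//; exact: Cinf_osc. Qed.

Lemma pderivs_osc_pure a b (x : 'rV[R]_m) : 0 < a ->
  pderivs (nseq r i0) (fun x : 'rV[R]_m => osc a b (x ord0 i0)) x =
  derive1n r P (a * x ord0 i0 + b).
Proof.
move=> a0; rewrite pderivs_osc all_pred1_nseq size_nseq mulVf ?mul1r//.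
by rewrite expf_neq0// lt0r_neq0.
Qed.

(** Either [l] contains another direction and the derivative is 0, or it is pure of order below [r]
    and at least one factor [1 / a] remains. *)
Lemma pderivs_osc_small a b l (x : 'rV[R]_m) : 1 <= a -> (size l <= r)%N -> l != nseq r i0 ->
  `|pderivs l (fun x : 'rV[R]_m => osc a b (x ord0 i0)) x| <= C / a.
Proof.
move=> a1 lr ln; have a0 : 0 < a by apply: lt_le_trans a1.
have C0 : 0 <= C by apply: le_trans (PC 0 (leq0n r)); exact: normr_ge0.
rewrite pderivs_osc; case: ifP => [/all_pred1P E|_]; last by rewrite normr0 divr_ge0// ltW.
have lt_r : (size l < r)%N.
  by rewrite ltn_neqAle lr andbT; apply: contraNneq ln => <-; apply/eqP.
rewrite normrM mulrC; apply: ler_pM => //; first exact: PC.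
rewrite ger0_norm; last by rewrite mulr_ge0 ?invr_ge0 ?exprn_ge0 ?(ltW a0).
rewrite mulrC ler_pdivrMr ?exprn_gt0// mulrC ler_pdivlMr// -exprSr.
by rewrite ler_weXn2l.
Qed.

(** As [f] is chosen before [a], its derivatives have a bound [M] independent of [a].
    [pderivsM_approx] gives an error [3^r M C / a]; for [l] other than the pure list, the main term
    adds at most [M C / a]. *)
Lemma osc_mul_near (f : 'rV[R]_m -> R) b eta : Cinf f -> 0 < eta ->
  \forall a \near +oo, forall l x, (size l <= r)%N -> cube x ->
  `|pderivs l (fun x => f x * osc a b (x ord0 i0)) x -
    (if l == nseq r i0 then f x * derive1n r P (a * x ord0 i0 + b) else 0)| <= eta.
Proof.
move=> Cf eta0; have [M M0 HM] := pderivs_bounded r Cf.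
have C0 : 0 <= C by apply: le_trans (PC 0 (leq0n r)); exact: normr_ge0.
near=> a => l x lr Cx.
have a1 : 1 <= a by near: a; exact: nbhs_pinfty_ge.
have a0 : 0 < a by apply: lt_le_trans a1.
have aK : (3 ^+ r + 1) * (M * C) / eta <= a by near: a; apply: nbhs_pinfty_ge; exact: num_real.
have {}aK : (3 ^+ r + 1) * (M * (C / a)) <= eta.
  by rewrite !mulrA ler_pdivrMr// -mulrA [eta * a]mulrC -ler_pdivrMr.
have Ca : 0 <= C / a by rewrite divr_ge0// ltW.
have subP l' : subseq l' l -> l' != l -> l' != nseq r i0.
  move=> s ne; apply: contraNneq ne => e.
  by rewrite -(geq_leqif (size_subseq_leqif s)) e size_nseq.
have MC : 0 <= M * (C / a) by rewrite mulr_ge0.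
have H := @pderivsM_approx _ _ l f (fun x => osc a b (x ord0 i0)) x M (C / a) Cf (Cinf_osc_coord a b) M0 Ca.
have {}H : `|pderivs l (fun x => f x * osc a b (x ord0 i0)) x -
    f x * pderivs l (fun x : 'rV[R]_m => osc a b (x ord0 i0)) x| <= 3 ^+ r * (M * (C / a)).
  apply: le_trans (H _ _) _.
  - by move=> l' /size_subseq sz; apply: HM => //; exact: leq_trans sz lr.
  - move=> l' s ne; apply: pderivs_osc_small => //; last exact: subP.
    exact: leq_trans (size_subseq s) lr.
  - by apply: ler_wpM2r => //; apply: ler_weXn2l => //; rewrite ler1n.
case: eqP => [le|/eqP ln].
  move: H; rewrite {2}le pderivs_osc_pure// => /le_trans; apply.
  by move: aK; rewrite mulrDl mul1r; lra.
rewrite subr0.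
have h2 := ler_pM (normr_ge0 _) (normr_ge0 _)
  (HM [::] x isT Cx) (pderivs_osc_small b x a1 lr ln).
rewrite -normrM in h2.
have := ler_distD (f x * pderivs l (fun x : 'rV[R]_m => osc a b (x ord0 i0)) x)
  (pderivs l (fun x => f x * osc a b (x ord0 i0)) x) 0.
rewrite !subr0 /= in h2 *; rewrite mulrDl mul1r in aK; lra.
Unshelve. all: by end_near. Qed.

Variables (I : finType) (phi : I -> 'rV[R]_m -> R) (lam : 'rV[R]_m -> R).
Hypotheses (Cphi : forall p, Cinf (phi p)) (Clam : Cinf lam).

Definition wave a p (x : 'rV[R]_m) : R :=
  phi p x * lam x * osc a 0 (x ord0 i0) + phi p x * (1 - lam x) * osc a (1 / 2) (x ord0 i0).

(* The factor by which the pure derivative of [wave] multiplies [phi], up to O(1/a). *)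
Definition profile a (x : 'rV[R]_m) : R :=
  lam x * derive1n r P (a * x ord0 i0) + (1 - lam x) * derive1n r P (a * x ord0 i0 + 1 / 2).

Lemma Cinf_phi_lam p : Cinf (fun x => phi p x * lam x).
Proof. exact: CinfM. Qed.

Lemma Cinf_phi_lamC p : Cinf (fun x => phi p x * (1 - lam x)).
Proof. by apply: CinfM => // n; apply: CnB; [exact: Cn_cst|exact: Clam]. Qed.

Lemma Cinf_wave a p : Cinf (wave a p).
Proof.
apply: CinfD; apply: CinfM; [exact: Cinf_phi_lam|exact: Cinf_osc_coord| |exact: Cinf_osc_coord].
exact: Cinf_phi_lamC.
Qed.

Lemma wave_near eta : 0 < eta ->
  \forall a \near +oo, forall p l x, (size l <= r)%N -> cube x ->
  `|pderivs l (wave a p) x - (if l == nseq r i0 then phi p x * profile a x else 0)| <= eta.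
Proof.
move=> eta0; have e2 : 0 < eta / 2 by rewrite divr_gt0.
(* [I] is finite, so one threshold for [a] serves all [p]. *)
apply: filter_forall => p.
have H1 := osc_mul_near 0 (Cinf_phi_lam p) e2.
have H2 := osc_mul_near (1 / 2) (Cinf_phi_lamC p) e2.
apply: filterS2 H1 H2 => a H1 H2 l x lr Cx.
have {}H1 := H1 l x lr Cx; have {}H2 := H2 l x lr Cx.
rewrite /wave pderivsD; last 2 first.
- by apply: CinfM; [exact: Cinf_phi_lam|exact: Cinf_osc_coord].
- by apply: CinfM; [exact: Cinf_phi_lamC|exact: Cinf_osc_coord].
move: H1 H2; set A := pderivs l _ x; set B := pderivs l _ x => H1 H2.
set D1 := (X in `|A - X|) in H1; set D2 := (X in `|B - X|) in H2.
have -> : (if l == nseq r i0 then phi p x * profile a x else 0) = D1 + D2.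
  by rewrite /D1 /D2 /profile; case: ifP => _; rewrite ?addr0//; ring.
rewrite [eta]splitr (_ : A + B - _ = (A - D1) + (B - D2)); last by ring.
exact: le_trans (ler_normD _ _) (lerD H1 H2).
Qed.

End Oscillation.

(** * The wiggling isotopy *)

Section IsotopyShear.
Variable R : realType.

Lemma itv_perturb (u v a b : R) : `|u| < 1 - a -> `|v| <= b -> b <= a -> -1 <= u + v <= 1.
Proof.
move=> /ltr_normlP[? ?] /ler_normlP[? ?] ?.
by rewrite -ler_norml; apply/ler_normlP; split; lra.
Qed.

(** Applied to [rsubmx], which extracts [x] from the row [(t, x)] in which an isotopy has to be
    jointly smooth. *)
Lemma Cn_comp_linear (V W : normedModType R) (A : {linear V -> W}) n (f : W -> R) :
  continuous A -> Cn n f -> Cn n (fun x => f (A x)).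
Proof.
move=> Ac; elim: n f => [|n IH] f Cf.
  by split=> // x; apply: continuous_comp; [exact: Ac|exact: Cn_continuous Cf _].
apply: CnS_intro => [x|v].
  by apply: continuous_comp; [exact: Ac|exact: Cn_continuous Cf _].
exists (fun x => 'D_(A v) f (A x)); split; last exact: IH (Cn_derive Cf (A v)).
move=> x; apply/is_derive_lineP.
rewrite (_ : (fun h : R => _) = (fun h : R => f (h *: A v + A x))).
  exact: (is_derive_lineP f (A x) (A v) _).1 (Cn_isd Cf _ _).
by apply/funext => h; rewrite linearP.
Qed.

Lemma rsubmx_continuous m : continuous (@rsubmx R 1 1 m).
Proof. by move=> x; exact/differentiable_continuous/differentiable_rsubmx. Qed.

Lemma prod_01 (I : Type) (s : seq I) (Q : pred I) (f : I -> R) :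
  (forall i, 0 <= f i <= 1) -> 0 <= \prod_(i <- s | Q i) f i <= 1.
Proof.
move=> f01; rewrite prodr_ge0 => [|i _]; last by case/andP: (f01 i).
by apply: prodr_ile1 => i _; exact: f01.
Qed.

Variables (q m : nat) (j : 'I_m) (beta : 'rV[R]_q -> R) (g : 'rV[R]_m -> R).
Variables (chi : R -> R) (delta rho L : R).
Hypotheses (betac : continuous beta) (beta01 : forall z, 0 <= beta z <= 1).
Hypotheses (Cg : Cinf g) (gd : forall x, `|g x| <= delta).
Hypothesis gj : forall x s, g (x + s *: evec R j) = g x.
Hypotheses (Cchi : Cinf chi) (chi01 : forall u, 0 <= chi u <= 1).
Hypothesis chi0 : forall u, 1 - rho <= `|u| -> chi u = 0.
Hypothesis chiL : forall u, `|derive1 chi u| <= L.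
Hypotheses (rho0 : 0 <= rho) (d_rho : delta <= rho) (dL : delta * L <= 1 / 2).

(** [g] is the height to which the face is pushed, [beta] switches the motion off near the boundary
    of the parameter cube, and [chi] cuts it off along the direction of the shear. *)
Definition shear_isotopy z t := shear j (fun x => t * beta z * g x) chi.

Lemma shear_isotopyE z t x i : shear_isotopy z t x ord0 i =
  x ord0 i + t * beta z * g x * chi (x ord0 j) * (i == j)%:R.
Proof. exact: add_evecE. Qed.

Lemma shear_coef_le z (t : R) x : 0 <= t <= 1 -> `|t * beta z * g x| <= delta.
Proof.
move=> /andP[t0 t1]; have /andP[b0 b1] := beta01 z.
rewrite normrM ger0_norm ?mulr_ge0//; apply: le_trans (gd x).
by rewrite ler_piMl// mulr_ile1.
Qed.

Lemma shear_isotopy_le z (t : R) x : 0 <= t <= 1 -> `|shear_isotopy z t x - x| <= delta.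
Proof.
move=> t01; rewrite addrC addKr normrZ normrM.
have e1 : `|evec R j| <= 1.
  rewrite [leLHS]/Num.Def.normr/= mx_normrE.
  apply: bigmax_le => // -[a b] _ /=; rewrite mxE.
  by case: (_ && _); rewrite ?normr1 ?normr0.
have /andP[c0 c1] := chi01 (x ord0 j).
apply: (@le_trans _ _ (`|t * beta z * g x| * 1)).
  by rewrite -[leLHS]mulrA ler_wpM2l// mulr_ile1// ger0_norm.
by rewrite mulr1 shear_coef_le.
Qed.

(** Points with [|x_j| >= 1 - rho] are fixed and all others move by at most [delta <= rho]. The
    converse puts the preimages of points of the cube in the cube. *)
Lemma shear_isotopy_cube z (t : R) x : 0 <= t <= 1 -> cube x <-> cube (shear_isotopy z t x).
Proof.
move=> t01; split=> Cx i; move: (Cx i); rewrite shear_isotopyE; case: eqP => [->|_];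
  rewrite ?mulr0 ?addr0// mulr1.
  have [/chi0 ->|lt1] := leP (1 - rho) `|x ord0 j|; first by rewrite mulr0 addr0.
  have := shear_coef_le z x t01; have /andP[c0 c1] := chi01 (x ord0 j).
  move=> H _; have : `|t * beta z * g x * chi (x ord0 j)| <= delta.
    by rewrite normrM (ger0_norm c0); apply: le_trans H; rewrite ler_piMr.
  by move=> /(itv_perturb lt1); apply.
have [xj|xj] := leP `|x ord0 j| 1; first by move=> _; rewrite -ler_norml.
by rewrite chi0 ?mulr0 ?addr0// ltW// (le_lt_trans _ xj)// gerBl.
Qed.

Lemma isotopy_shear : isotopy_family shear_isotopy.
Proof.
split.
- by move=> z _ x; apply/rowP => i; rewrite shear_isotopyE !mul0r addr0.
- move=> z _ i; apply: Cinf_smooth => n.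
  under eq_fun do rewrite shear_isotopyE.
  have Ccoord k : Cn n (fun y : 'rV[R]_(1 + m) => rsubmx y ord0 k).
    by under eq_fun do rewrite mxE; exact: Cn_coord.
  apply: CnD => //; apply: CnM; last exact: Cn_cst.
  apply: CnM; last exact: Cn_comp.
  apply: CnM; last exact: (@Cn_comp_linear _ _ (@rsubmx R 1 1 m) n g (@rsubmx_continuous m) (Cg n)).
  by apply: CnM; [exact: Cn_coord|exact: Cn_cst].
- move=> z t _ t01.
  have cC : Cinf (fun x => t * beta z * g x).
    by move=> n; apply: CnM; [exact: Cn_cst|exact: Cg].
  have chi1 u : `|chi u| <= 1 by have /andP[? ?] := chi01 u; rewrite ger0_norm.
  have L0 : 0 <= L by apply: le_trans (chiL 0).
  have cL x : `|t * beta z * g x| * L <= 1 / 2.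
    by apply: le_trans dL; rewrite ler_wpM2r// shear_coef_le.
  have cj x s : t * beta z * g (x + s *: evec R j) = t * beta z * g x by rewrite gj.
  have [G [Gs FG GF]] := shear_inverse cC Cchi chiL chi1 cL cj.
  exists G; split=> //; apply/seteqP; split.
    by move=> _ [x Cx <-]; exact: (shear_isotopy_cube z x t01).1 Cx.
  move=> y Cy; exists (G y); last exact: GF.
  by apply: (shear_isotopy_cube z (G y) t01).2; rewrite /shear_isotopy GF.
- apply: continuous_subspaceT => p.
  have c22 : {for p, continuous (fun p : 'rV[R]_q * (R * 'rV[R]_m) => p.2.2)}.
    by apply: cvg_comp; [exact: cvg_snd|exact: cvg_snd].
  apply: cvgD; first exact: c22.
  apply: cvgZ; last exact: cvg_cst.
  apply: cvgM; last first.
    pose fj (p : 'rV[R]_q * (R * 'rV[R]_m)) := p.2.2 ord0 j.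
    apply: (@cvg_comp _ _ _ fj chi); last exact: Cn_continuous (Cchi 0%N) _.
    apply: (@cvg_comp _ _ _ (fun p : 'rV[R]_q * (R * 'rV[R]_m) => p.2.2) (fun x : 'rV[R]_m => x ord0 j)).
      exact: c22.
    exact: coord_continuous.
  apply: cvgM; last first.
    by apply: cvg_comp; [exact: c22|exact: Cn_continuous (Cg 0%N) _].
  apply: cvgM.
    by apply: cvg_comp; [exact: cvg_snd|exact: cvg_fst].
  by apply: cvg_comp; [exact: cvg_fst|exact: betac].
Qed.

(** Only the coordinate [j] moves. The second alternative serves [k = 0], where [j] may be the first
    coordinate. *)
Lemma shear_isotopy_derive z t x v i : i != j \/ (forall y, g y = 0) ->
  ('D_v (shear_isotopy z t) x) ord0 i = v ord0 i.
Proof.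
move=> H.
have C1 k : Cinf (fun y => shear_isotopy z t y ord0 k).
  move=> n; under eq_fun do rewrite shear_isotopyE.
  apply: CnD; first exact: Cn_coord.
  apply: CnM; last exact: Cn_cst.
  apply: CnM; last by apply: Cn_comp => //; exact: Cn_coord.
  by apply: CnM => //; exact: Cn_cst.
rewrite derive_mx; last first.
  by apply/derivable_mxP => a k; rewrite ord1; exact: Cn_derivable (C1 k 1%N) _ _.
rewrite mxE (_ : (fun t0 => _) = (fun y : 'rV[R]_m => y ord0 i)); last first.
  apply/funext => y; rewrite shear_isotopyE.
  by case: H => [/negbTE ->|->]; rewrite !(mulr0, mul0r) addr0.
by have [_ ->] := is_derive_coord i x v.
Qed.

End IsotopyShear.

(** * The graph of the wiggle and the profile near it *)

Section ProfileOne.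
Variables (R : realType) (m r k : nat) (i0 j : 'I_m) (P w S : R -> R) (delta : R).
Hypotheses (Cw : Cinf w) (w0 : w 0 = 1).
Hypothesis Pw0 : forall u, w u != 0 -> derive1n r P u = 1.
Hypothesis Pw1 : forall u, w u != 1 -> derive1n r P (u + 1 / 2) = 1.
Hypotheses (CS : Cinf S) (S0 : forall u : R, u <= 0 -> S u = 0) (S1 : forall u : R, 1 <= u -> S u = 1).

(* When [k = 0] the face is a point and needs no wiggling; this also covers
   [m = 1], where no direction transverse to the first one is available. *)
Definition height_cut (x : 'rV[R]_m) : R := if k == 0%N then 1 else S (3 / delta * x ord0 j + -1).
Definition wiggle (u : R) : R := if k == 0%N then 0 else w u.

Lemma Cinf_height_cut : Cinf height_cut.
Proof.
move=> n; rewrite /height_cut; case: eqP => _; first exact: Cn_cst.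
apply: (@Cn_comp R _ n (fun u : R => S (3 / delta * u + -1))
  (fun x : 'rV[R]_m => x ord0 j)); last exact: Cn_coord.
by apply: (@Cn_comp R R n S); [exact: CS|exact: Cinf_affine].
Qed.

Lemma Cinf_wiggle : Cinf wiggle.
Proof. by move=> n; rewrite /wiggle; case: eqP => _; [exact: Cn_cst|exact: Cw]. Qed.

(** Near the graph, an oscillation gets a nonzero weight only where its r-th derivative is 1, and
    the weights add up to 1. For [k = 0] the first oscillation is used alone, near [x_0 = 0], where
    [w] is close to 1. *)
Lemma profile_one a (x : 'rV[R]_m) : 0 < delta -> (k = 0%N -> x ord0 i0 = 0) ->
  x ord0 j = delta * wiggle (a * x ord0 i0) ->
  \forall y \near x, profile r i0 P height_cut a y = 1.
Proof.
move=> d0; rewrite /wiggle /profile /height_cut; case: (eqVneq k 0%N) => [k0|kn0] x0 xj.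
  have Cf : Cn 0 (fun y : 'rV[R]_m => w (a * y ord0 i0)).
    apply: Cn_comp; first exact: Cw.
    by apply: CnM; [exact: Cn_cst|exact: Cn_coord].
  have /cvgrPdist_lt fx : {for x, continuous (fun y : 'rV[R]_m => w (a * y ord0 i0))}.
    exact: Cn_continuous Cf x.
  have := fx 1 ltr01; rewrite x0// mulr0 w0; apply: filterS => y.
  move=> Hy; rewrite subrr mul0r addr0 mul1r Pw0//.
  by apply: contraTneq Hy => ->; rewrite subr0 normr1 ltxx.
have Cf : Cn 0 (fun y : 'rV[R]_m => delta^-1 * y ord0 j - w (a * y ord0 i0)).
  apply: CnB; first by apply: CnM; [exact: Cn_cst|exact: Cn_coord].
  apply: Cn_comp; first exact: Cw.
  by apply: CnM; [exact: Cn_cst|exact: Cn_coord].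
have q4 : 0 < 1 / 4 :> R by lra.
have /cvgrPdist_lt fx : {for x, continuous (fun y : 'rV[R]_m => delta^-1 * y ord0 j - w (a * y ord0 i0))}.
  exact: Cn_continuous Cf x.
have := fx _ q4; rewrite xj mulKf ?lt0r_neq0// subrr; apply: filterS => y.
rewrite sub0r normrN => /ltr_normlP[h1 h2].
rewrite [3 / delta]mulrC [delta^-1 * 3]mulrC -mulrA.
set v := delta^-1 * y ord0 j in h1 h2 *.
(* [S (3 v - 1)] is 0 for [v <= 1/3] and 1 for [v >= 2/3]. As [v] is within 1/4 of [w], the first
   bound failing gives [w > 1/12] and the second failing gives [w < 11/12]. *)
have e1 : S (3 * v + -1) = 0 \/ derive1n r P (a * y ord0 i0) = 1.
  have [v0|v0] := leP (3 * v + -1) 0; [by left; exact: S0|right].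
  apply: Pw0; apply: lt0r_neq0; lra.
have e2 : S (3 * v + -1) = 1 \/ derive1n r P (a * y ord0 i0 + 1 / 2) = 1.
  have [v0|v0] := leP 1 (3 * v + -1); [by left; exact: S1|right].
  apply: Pw1; rewrite lt_eqF//; lra.
case: e1 => E1; case: e2 => E2; rewrite ?E1 ?E2; try ring.
by move: E2; rewrite E1 => /eqP; rewrite eq_sym oner_eq0.
Qed.

End ProfileOne.

Lemma finite_lower_bound (R : realType) (I : finType) (d : I -> R) :
  (forall i, 0 < d i) -> exists2 e, 0 < e & forall i, e <= d i.
Proof.
move=> d0; near (0 : R)^'+ => e; exists e => // i.
move: i; near: e; apply: filter_forall => i; exact: nbhs_right_le.
Unshelve. all: by end_near. Qed.

Lemma near_coord_gt (R : realType) m (x : 'rV[R]_m) i (b : R) : b < `|x ord0 i| ->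
  \forall y \near x, b < `|(y : 'rV[R]_m) ord0 i|.
Proof.
move=> bx; have cc : {for x, continuous (fun y : 'rV[R]_m => `|y ord0 i|)}.
  by apply: continuous_comp; [exact: coord_continuous|exact: norm_continuous].
exact: (cvgr_gt _ cc _ bx).
Qed.

(** * Choice of the parameters and verification of the estimates *)

Theorem mainTheorem15 (R : realType) (k m n q r : nat) (hkm : (k < m)%N)
  (sigma : 'rV[R]_q -> jsection R m n)
  (Hcont : jfamily_continuous r sigma)
  (Hbdm : open_nbhd_with (@cube_bd R m)
            (fun U => forall z, cube z -> jvanish r (sigma z) (U `&` @cube R m)))
  (Hperp : forall z, cube z -> jperp_zero r (sigma z) (@cube R m))
  (Hbdq : open_nbhd_with (@cube_bd R q)
            (fun W => forall z, (W `&` @cube R q) z -> jvanish r (sigma z) (@cube R m)))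
  (eps : R) (heps : 0 < eps) :
  exists (F : 'rV[R]_q -> R -> 'rV[R]_m -> 'rV[R]_m)
         (h : 'rV[R]_q -> 'I_n -> 'rV[R]_m -> R),
    isotopy_family F /\
        (forall z, cube z -> forall j, smooth (h z j)) /\
        jfamily_continuous r (fun z => jet (h z)) /\
        (forall z, cube z ->
           open_nbhd_with (F z 1 @` @cube_face R m k)
             (fun U => jclose r (jet (h z)) (sigma z) (U `&` @cube R m) eps)) /\
        (forall z, cube z -> jperp_small r (jet (h z)) (@cube R m) eps) /\
        (forall z t x, cube z -> 0 <= t <= 1 -> cube x -> `|F z t x - x| < eps) /\
        open_nbhd_with (@cube_bd R m)
          (fun U => forall z t, cube z -> 0 <= t <= 1 ->
             (forall x, (U `&` @cube R m) x -> F z t x = x)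
             /\ jvanish r (jet (h z)) (U `&` @cube R m)) /\
        open_nbhd_with (@cube_bd R q)
          (fun W => forall z t, (W `&` @cube R q) z -> 0 <= t <= 1 ->
             (forall x, cube x -> F z t x = x) /\ jvanish r (jet (h z)) (@cube R m)) /\
        (forall z t x v, cube z -> 0 <= t <= 1 -> cube x -> inV v ->
           inV ('D_v (F z t) x)).

Proof.
have m0 : (0 < m)%N by apply: leq_ltn_trans hkm.
(* The shear is along the last coordinate: it vanishes on the face because [k <= j], and is not the
   first one unless [k = 0]. *)
pose i0 : 'I_m := Ordinal m0; pose j : 'I_m := rev_ord i0.
have jE : val j = m.-1 by rewrite /= subn1.
have kj : (k <= j)%N by rewrite -[nat_of_ord j]/(val j) jE -ltnS prednK.
have i0j : k != 0%N -> i0 != j.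
  move=> kn0; apply: contraNneq kn0 => e; move: kj; rewrite -e leqn0 => /eqP ->//.
pose pur := @pure_index m r.
have mpur : mlist pur = nseq r i0 by exact/(mlist_pureP r pur (erefl : val i0 = 0%N)).
have opur : (morder pur <= r)%N by rewrite -size_mlist mpur size_nseq.
have mpureP a : (mlist a == nseq r i0) = false -> a <> pur.
  by move=> /eqP H E; apply: H; rewrite E.
have [U [Uo [UB HU]]] := Hbdm.
have [rho0 rho00 Hrho0] := collar Uo UB.
(* Nested collars: [sigma] vanishes beyond [1 - 4 rho], its regularisation beyond [1 - 3 rho], and
   [chi] falls from 1 to 0 between [1 - 2 rho] and [1 - rho]. *)
have [rho [rho_gt0 rho4 rho_small]] : exists rho : R, [/\ 0 < rho, 4 * rho <= rho0 & 4 * rho <= 1].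
  exists (Num.min rho0 1 / 4); split.
  - by rewrite divr_gt0// lt_min rho00 ltr01.
  - by rewrite mulrC divfK// ge_min lexx.
  - by rewrite mulrC divfK// ge_min lexx orbT.
have sig0x z x a l : cube z -> cube x -> (exists i, 1 - 4 * rho < `|x ord0 i|) ->
    (morder a <= r)%N -> sigma z x a l = 0.
  move=> Cz Cx [i xi] ar; apply: (HU z Cz x _ a l ar); split=> //.
  by apply: Hrho0 => //; exists i; apply: le_lt_trans xi; rewrite lerD2l lerN2.
have [W [Wo [WB HW]]] := Hbdq.
have [rhoq rhoq0 Hrhoq] := collar Wo WB.
have sig0z z x a l : cube z -> cube x -> (exists i, 1 - rhoq < `|z ord0 i|) ->
    (morder a <= r)%N -> sigma z x a l = 0.
  by move=> Cz Cx zi ar; apply: (HW z _ x Cx a l ar); split=> //; exact: Hrhoq.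
pose s z x l := sigma z x pur l.
have sc l : {within @dom_zx R q m, continuous (fun p => s p.1 p.2 l)} by exact: Hcont.
have [M M0 HM] : exists2 M, 0 <= M & forall l z x, cube z -> cube x -> `|s z x l| <= M.
  have /choice[Ml HMl] : forall l, exists M, 0 <= M /\ forall p, @dom_zx R q m p -> `|s p.1 p.2 l| <= M.
    by move=> l; have [M0 M00 HM] := dom_zx_bounded (sc l); exists M0.
  exists (\sum_l Ml l); first by apply: sumr_ge0 => l _; exact: (HMl l).1.
  move=> l z x Cz Cx; apply: le_trans ((HMl l).2 (z, x) (conj Cz Cx)) _.
  by rewrite (bigD1 l)//= lerDl; apply: sumr_ge0 => l' _; exact: (HMl l').1.
have e2 : 0 < eps / 2 by rewrite divr_gt0.
have [d d0 Hd] : exists2 d, 0 < d & forall l z x y, cube z -> cube x -> cube y ->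
    `|x - y| < d -> `|s z x l - s z y l| < eps / 2.
  have /choice[dl Hdl] : forall l, exists d, 0 < d /\ forall z x y, cube z -> cube x -> cube y ->
      `|x - y| < d -> `|s z x l - s z y l| < eps / 2.
    by move=> l; have [d d0 Hd] := dom_zx_uniform e2 (sc l); exists d.
  have [d d0 Hd] := finite_lower_bound (fun l => (Hdl l).1).
  exists d => // l z x y Cz Cx Cy xy; apply: (Hdl l).2 => //; exact: lt_le_trans (Hd l).
have [d' [d'0 d'd d'rho]] : exists d', [/\ 0 < d', d' <= d & d' <= rho].
  by exists (Num.min d rho); rewrite lt_min d0 rho_gt0 !ge_min !lexx orbT.
have [I [pt [phi [Cpt Cphi phi0 phi1 phid]]]] := partition_of_unity m d'0.
pose stil z x l := \sum_p s z (pt p) l * phi p x.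
(* At [x], [stil z] is a weighted mean of values of [s z] at nodes closer to [x] than [d]. *)
have stil_close z x l : cube z -> cube x -> `|stil z x l - s z x l| <= eps / 2.
  move=> Cz Cx.
  have -> : stil z x l - s z x l = \sum_p (s z (pt p) l - s z x l) * phi p x.
    under eq_bigr do rewrite mulrBl.
    by rewrite big_split/= sumrN -mulr_sumr phi1// mulr1.
  apply: (le_trans (ler_norm_sum _ _ _)).
  rewrite -[leRHS]mulr1 -[X in _ <= _ * X](phi1 x Cx) mulr_sumr; apply: ler_sum => p _.
  rewrite normrM (ger0_norm (phi0 p x)).
  have [->|ne] := eqVneq (phi p x) 0; first by rewrite !mulr0.
  apply: ler_wpM2r => //; apply: ltW; apply: Hd => //; rewrite distrC.
  apply: mx_norm_lt => // i; rewrite !mxE.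
  by apply: lt_le_trans d'd; rewrite ltNge; apply: contraNN ne => /phid ->.
(* If [phi p y] is nonzero, the node lies within [d' <= rho] of [y] in each coordinate, hence in the
   collar where [sigma] vanishes. *)
have s_phi0 z p (y : 'rV[R]_m) l : cube z -> (exists i, 1 - 3 * rho < `|y ord0 i|) ->
    s z (pt p) l * phi p y = 0.
  move=> Cz [i yi]; have [ge|lt] := leP d' `|y ord0 i - pt p ord0 i|.
    by rewrite (phid _ _ _ ge) mulr0.
  rewrite [s _ _ _]sig0x ?mul0r//; exists i.
  have := ler_distD (pt p ord0 i) (y ord0 i) 0; rewrite !subr0; lra.
have [chi [Cchi chi_1 chi_0 chi01]] := @bump_exists R (1 - 2 * rho) (1 - rho) ltac:(lra).
have [L L0 HL] := derive1n_bounded 1 Cchi chi_0.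
(* The bounds on [delta] keep the isotopy close to the identity, keep the cube invariant, and make
   the shears invertible, in this order. *)
have [delta [delta0 delta_eps delta_rho deltaL]] : exists delta : R,
    [/\ 0 < delta, delta < eps, delta <= rho & delta * L <= 1 / 2].
  pose D := 2 * (L + 1).
  have D0 : 0 < D by rewrite /D; lra.
  exists (Num.min (eps / 2) (Num.min rho D^-1)); split.
  - by rewrite !lt_min e2 rho_gt0 invr_gt0.
  - by rewrite gt_min; apply/orP; left; lra.
  - by rewrite !ge_min lexx orbT.
  - apply: (@le_trans _ _ (D^-1 * L)); first by rewrite ler_wpM2r// !ge_min lexx !orbT.
    by rewrite mulrC ler_pdivrMr// /D; lra.
(* Where [beta] is not 1, some coordinate of [z] exceeds [1 - rhoq] in absolute value, so [sigma z]
   is already 0 and no wiggling is required. *)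
have [chiq [Cchiq chiq_1 chiq_0 chiq01]] := @bump_exists R (1 - rhoq) (1 - rhoq / 2) ltac:(lra).
pose beta (z : 'rV[R]_q) := \prod_i chiq (z ord0 i).
have betac : continuous beta.
  have C0 : Cn 0 beta by apply: Cn_prod => i _; apply: Cn_comp; [exact: Cchiq|exact: Cn_coord].
  exact: Cn_continuous C0.
have beta01 z : 0 <= beta z <= 1 by apply: prod_01.
have [P [w [C [CP Cw [C0 PC] [w01 w0] [Pw0 Pw1]]]]] := wiggle_exists R r.
have [S [CS S0 S1 S01]] := smooth_step_exists R.
pose lam := height_cut k j S delta.
have Clam : Cinf lam := Cinf_height_cut k j delta CS.
(* Each of the [#|I|] waves contributes an error [eta] with a coefficient bounded by [M]. *)
have [eta eta0 Heta] : exists2 eta, 0 < eta & #|I|%:R * (M * eta) < eps / 2.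
  have K0 : 0 < #|I|%:R * M + 1 :> R by rewrite ltr_wpDl// mulr_ge0.
  exists (eps / 2 / (#|I|%:R * M + 1)); first by rewrite divr_gt0.
  rewrite mulrA mulrA ltr_pdivrMr// mulrC ltr_pM2l//; lra.
have : \forall a \near +oo, 0 < a /\ (forall p l x, (size l <= r)%N -> cube x ->
  `|pderivs l (wave r i0 P phi lam a p) x -
    (if l == nseq r i0 then phi p x * profile r i0 P lam a x else 0)| <= eta).
  near=> a; split; first by near: a; exact: nbhs_pinfty_gt.
  by near: a; exact: (wave_near i0 CP PC Cphi Clam eta0).
move=> /filter_ex[a [a0 Ha]].
(* The parameter [z] enters only through finitely many continuous coefficients: one [a] serves all
   [z], and the jets are jointly continuous. *)
pose h z l x := \sum_p s z (pt p) l * wave r i0 P phi lam a p x.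
have Cwave p : Cinf (wave r i0 P phi lam a p) by exact: Cinf_wave.
have jetE z ai l x : jet (h z) x ai l =
    \sum_p s z (pt p) l * pderivs (mlist ai) (wave r i0 P phi lam a p) x.
  by rewrite /jet /mdiff -/(mlist ai) /h pderivs_sumZ.
have jet_close z ai l x : cube z -> cube x -> (morder ai <= r)%N ->
    `|jet (h z) x ai l -
      (if mlist ai == nseq r i0 then stil z x l * profile r i0 P lam a x else 0)| < eps / 2.
  move=> Cz Cx ar; apply: le_lt_trans Heta.
  rewrite (_ : (if _ then _ else _) = \sum_p s z (pt p) l *
     (if mlist ai == nseq r i0 then phi p x * profile r i0 P lam a x else 0)); last first.
    case: ifP => _; last by rewrite big1// => p _; rewrite mulr0.
    by rewrite mulr_suml; apply: eq_bigr => p _; rewrite mulrA.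
  rewrite jetE -sumrB; apply: (le_trans (ler_norm_sum _ _ _)).
  rewrite mulr_natl -sumr_const; apply: ler_sum => p _.
  rewrite -mulrBr normrM; apply: ler_pM => //; first exact: HM.
  by apply: Ha => //; rewrite size_mlist.
(* The factor for [j] is left to the shear itself, so that [g] is constant in direction [j]. *)
pose g (x : 'rV[R]_m) := delta * wiggle k w (a * x ord0 i0) * \prod_(i | i != j) chi (x ord0 i).
have Cg : Cinf g.
  move=> N; apply: CnM.
    apply: CnM; first exact: Cn_cst.
    apply: (@Cn_comp R _ N (wiggle k w)); first exact: Cinf_wiggle.
    by apply: CnM; [exact: Cn_cst|exact: Cn_coord].
  by apply: Cn_prod => i _; apply: Cn_comp; [exact: Cchi|exact: Cn_coord].
have wiggle01 u : 0 <= wiggle k w u <= 1 by rewrite /wiggle; case: eqP => // _; rewrite lexx ler01.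
have gd x : `|g x| <= delta.
  have /andP[w0' w1'] := wiggle01 (a * x ord0 i0).
  have /andP[p0 p1] := prod_01 (index_enum 'I_m) (fun i => i != j) (fun i => chi01 (x ord0 i)).
  rewrite /g ger0_norm; last by rewrite !mulr_ge0// ltW.
  by rewrite -mulrA; apply: ler_piMr; [exact: ltW|exact: mulr_ile1].
have gj x t : g (x + t *: evec R j) = g x.
  rewrite /g; congr (_ * _ * _).
    rewrite /wiggle; case: (eqVneq k 0%N) => // kn0.
    by rewrite add_evecE (negbTE (i0j kn0)) mulr0 addr0.
  by apply: eq_bigr => i ij; rewrite add_evecE (negbTE ij) mulr0 addr0.
have HL' u : `|derive1 chi u| <= L by exact: HL.
exists (shear_isotopy j beta g chi), h.
split; first exact: (isotopy_shear betac beta01 Cg gd gj Cchi chi01 chi_0 HL' (ltW rho_gt0) delta_rho deltaL).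
split.
  move=> z _ l; apply: Cinf_smooth => N; apply: Cn_sum => p _.
  by apply: CnM; [exact: Cn_cst|exact: Cwave].
split.
  move=> ai l ar; apply/subspace_continuousP => -[z x] [Cz Cx].
  rewrite (_ : (fun p => _) = (fun p => \sum_i s p.1 (pt i) l *
     pderivs (mlist ai) (wave r i0 P phi lam a i) p.2)); last by apply/funext => p; exact: jetE.
  apply: cvg_big => [|i _]; first exact: add_continuous.
  apply: cvgM.
    have /subspace_continuousP/(_ (z, pt i) (conj Cz (Cpt i))) sci := sc l.
    apply: (@cvg_comp _ _ _ (fun p : 'rV[R]_q * 'rV[R]_m => (p.1, pt i)) (fun p => s p.1 p.2 l)) sci.
    move=> A /= [[B1 B2] /= [nB1 nB2] BA].
    exists (B1, setT) => /=; first by split=> //; exact: filterT.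
    move=> -[z' x'] [/= B1z' _] [Cz' Cx']; apply: (BA (z', pt i)); last exact: (conj Cz' (Cpt i)).
    by split=> //=; exact: nbhs_singleton nB2.
  apply: cvg_within_filter.
  apply: (@cvg_comp _ _ _ snd); first exact: cvg_snd.
  exact: Cn_continuous (Cinf_pderivs _ (Cwave i) 0%N) x.
split.
  move=> z Cz.
  (* The interior of the set where the estimate holds is the required neighborhood, provided the
     estimate holds near each point of the wiggled face. *)
  pose good := [set y | cube y -> forall ai l, (morder ai <= r)%N ->
    `|jet (h z) y ai l - sigma z y ai l| < eps].
  exists good^°; split; first exact: open_interior.
  split; last by move=> y [/interior_subset Gy Cy] ai l ar; exact: Gy.
  move=> _ [x [Cx xk] <-]; set y0 := shear_isotopy _ _ _ _ _ _ _.
  (* Where the wiggle is cut off by [beta] or by a factor of [g], the profile is not controlled, but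
     there [s] and [stil] both vanish. *)
  suff : \forall y \near y0, profile r i0 P lam a y = 1 \/
      (cube y -> forall l, stil z y l = 0 /\ s z y l = 0).
    apply: filterS => y Hy Cy ai l ar.
    have := jet_close z ai l y Cz Cy ar; case: eqP => [E|neq] H; last first.
      rewrite (Hperp z Cz y Cy ai l ar); last by move=> E; apply: neq; rewrite E.
      by apply: lt_trans H _; lra.
    move: H; rewrite (_ : ai = pur); last by apply/(mlist_pureP r ai (erefl : val i0 = 0%N)).
    rewrite -/(s z y l); case: Hy => [->|/(_ Cy l)[-> ->]] H; last first.
      by rewrite mul0r in H; apply: lt_trans H _; lra.
    rewrite mulr1 in H; have H2 := stil_close z y l Cz Cy.
    by have := ler_distD (stil z y l) (jet (h z) y pur l) (s z y l); lra.
  have [zi|zi] := pselect (exists i, 1 - rhoq < `|z ord0 i|).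
    apply: (@filterE _ (nbhs (y0 : 'rV[R]_m))) => y; right=> Cy l; split; last exact: sig0z.
    by apply: big1 => p _; rewrite [s _ _ _]sig0z ?mul0r.
  have bz : beta z = 1.
    apply: big1 => i _; apply: chiq_1; rewrite leNgt; apply/negP => H.
    by apply: zi; exists i.
  have [[i [ij xi]]|xi] := pselect (exists i, i != j /\ 1 - 3 * rho < `|x ord0 i|).
    have yi : 1 - 3 * rho < `|y0 ord0 i|.
      by rewrite shear_isotopyE (negbTE ij) mulr0 addr0.
    have := near_coord_gt yi; apply: filterS => y Hy; right=> Cy l; split.
      by apply: big1 => p _; apply: s_phi0 => //; exists i.
    by apply: sig0x => //; exists i; lra.
  have xj : x ord0 j = 0 by apply: xk.
  have gx : g x = delta * wiggle k w (a * x ord0 i0).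
    rewrite /g big1 ?mulr1// => i ij; apply: chi_1.
    have : `|x ord0 i| <= 1 - 3 * rho.
      by rewrite leNgt; apply/negP => H; apply: xi; exists i.
    lra.
  have chi00 : chi 0 = 1 by apply: chi_1; rewrite normr0; lra.
  have y0i : y0 ord0 i0 = x ord0 i0.
    rewrite shear_isotopyE gx; case: (eqVneq k 0%N) => [k0|/i0j/negbTE ->].
      by rewrite /wiggle k0 eqxx !(mulr0, mul0r) addr0.
    by rewrite mulr0 addr0.
  have : \forall y \near y0, profile r i0 P lam a y = 1.
    apply: (profile_one Cw w0 Pw0 Pw1 S0 S1 delta0).
      by move=> k0; rewrite y0i; apply: xk; rewrite k0.
    by rewrite y0i shear_isotopyE xj chi00 bz gx eqxx add0r !(mul1r, mulr1).
  by apply: filterS => y; left.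
split.
  move=> z Cz x Cx ai l ar neq.
  have := jet_close z ai l x Cz Cx ar; case: eqP => [/(mlist_pureP r ai (erefl : val i0 = 0%N))//|_].
  by rewrite subr0 => /lt_trans; apply; lra.
split.
  move=> z t x _ t01 _; apply: le_lt_trans delta_eps.
  exact: (shear_isotopy_le j beta01 gd chi01 z x t01).
split.
  exists [set x : 'rV[R]_m | exists i, 1 - rho < `|x ord0 i|]^°.
  split; first exact: open_interior.
  split.
    move=> x [_ [i xi]].
    have := @near_coord_gt _ _ x i (1 - rho); rewrite xi gtrBl => /(_ rho_gt0).
    by apply: filterS => y Hy; exists i.
  move=> z t Cz t01; split=> x [/interior_subset[i xi] Cx].
    apply/rowP => i'; rewrite shear_isotopyE /g.
    have [ij|ij] := eqVneq i j.
      by rewrite -ij chi_0 ?(mulr0, mul0r, addr0)// ltW.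
    by rewrite (bigD1 i)//= [chi (x ord0 i)]chi_0 ?(mulr0, mul0r, addr0)// ltW.
  move=> ai l ar; rewrite jetE; apply: big1 => p _.
  (* A term with nonzero coefficient has [phi p] equal to 0 near [x], which kills all derivatives of
     its wave at [x]. *)
  have [->|sne] := eqVneq (s z (pt p) l) 0; first by rewrite mul0r.
  rewrite (@pderivs_local _ _ _ _ (fun=> 0)) ?pderivs_cst0 ?mulr0//.
  have := near_coord_gt xi; apply: filterS => y yi.
  have /eqP : s z (pt p) l * phi p y = 0 by apply: s_phi0 => //; exists i; lra.
  by rewrite mulf_eq0 (negbTE sne)/= => /eqP E; rewrite /wave E !mul0r addr0.
split.
  exists [set z : 'rV[R]_q | exists i, 1 - rhoq / 2 < `|z ord0 i|]^°.
  split; first exact: open_interior.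
  split.
    move=> z [_ [i zi]].
    have := @near_coord_gt _ _ z i (1 - rhoq / 2); rewrite zi gtrBl => /(_ ltac:(lra)).
    by apply: filterS => y Hy; exists i.
  move=> z t [/interior_subset[i zi] Cz] t01; split=> x Cx.
    apply/rowP => i'; rewrite shear_isotopyE /beta (bigD1 i)//= chiq_0 ?ltW//.
    by rewrite !(mulr0, mul0r) addr0.
  move=> ai l ar; rewrite jetE; apply: big1 => p _.
  by rewrite [s _ _ _]sig0z ?mul0r//; exists i; lra.
move=> z t x v _ _ _ Hv i i0E.
(* Membership in [V] concerns the first component alone, which the shear keeps if [j] is another
   coordinate; otherwise [k = 0] and [g] is 0. *)
have -> : i = i0 by apply/val_inj.
rewrite (shear_isotopy_derive beta Cg Cchi); first exact: Hv.
case: (eqVneq k 0%N) => [k0|/i0j]; last by left.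
by right=> y; rewrite /g /wiggle k0 eqxx mulr0 mul0r.
Unshelve. all: by end_near. Qed.
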